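(* Let $\mu$ be a nonnegative Borel measure on $\mathbb{R}^+$ with $\mu(\mathbb{R}^+)\in(0,\infty)$, let $f\in C(\mathbb{R}^+;(0,\infty))$, let $h\in L^1_{loc}(\mathbb{R}^+;\mathbb{R})$ be such that $H(t):=\int_0^t h(s)\,ds\ge 0$ for all $t\ge0$, and let $\psi>0$. Suppose there is $\phi\in C^1(\mathbb{R}^+;(0,\infty))$ with $\phi'(x)>0$ for all $x\ge0$, $\lim_{x\to\infty}\phi(x)=\infty$, $\lim_{x\to\infty}\phi'(x)=0$ and $\lim_{x\to\infty}f(x)/\phi(x)=1$. Suppose the limit $$L_f(H):=\lim_{t\to\infty}\frac{H(t)}{\mu(\mathbb{R}^+)\int_0^t f(H(s))\,ds}$$ exists and lies in $(0,\infty)$. Then every solution $x$ of $$x'(t)=\int_{[0,t]}\mu(ds)\,f(x(t-s))+h(t),\quad t>0,\qquad x(0)=\psi,$$ obeys $$1\le\liminf_{t\to\infty}\frac{F(x(t))}{\mu(\mathbb{R}^+)t}\le\limsup_{t\to\infty}\frac{F(x(t))}{\mu(\mathbb{R}^+)t}\le 1+L_f(H),$$ where $F(x)=\int_1^x\frac{du}{f(u)}$ for $x>0$. If, in addition, $\phi$ can be chosen such that $\phi'$ is non-increasing on $[0,\infty)$ (so that $\phi'(x)\downarrow0$ as $x\to\infty$), then also $$\liminf_{t\to\infty}\frac{x(t)}{H(t)}\ge 1+\frac{1}{L_f(H)}.$$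
   Context: $\mathbb{R}^+=[0,\infty)$. A solution is a locally absolutely continuous function $x:[0,\infty)\to[0,\infty)$ satisfying the equation for almost every $t\ge0$ together with the initial condition. *)

(* Defs.v *)
From mathcomp Require Import all_boot all_order all_algebra.
From mathcomp Require Import all_classical all_reals all_analysis.

Set Implicit Arguments.
Unset Strict Implicit.
Unset Printing Implicit Defensive.

Import Order.TTheory GRing.Theory Num.Theory.
Import numFieldNormedType.Exports.

Local Open Scope classical_set_scope.
Local Open Scope ring_scope.

(* Functions on R^+ = [0, +oo[ are represented by total functions R -> R whose
   values at negative arguments are irrelevant, and a Borel measure on R^+ by a
   Borel measure on R of which only the restriction to R^+ matters. *)

Definition halfline (R : realType) : set R := `[0, +oo[.
Arguments halfline : clear implicits.

Definition cont_pos (R : realType) (f : R -> R) : Prop :=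
  {within halfline R, continuous f} /\ (forall x : R, 0 <= x -> 0 < f x).

(* The derivative is relative to R^+, hence one-sided at 0. *)
Definition has_deriv_halfline (R : realType) (g dg : R -> R) : Prop :=
  forall x : R, 0 <= x ->
    (g y - g x) / (y - x) @[y --> within (halfline R) x^'] --> dg x.

Definition C1_halfline (R : realType) (g dg : R -> R) : Prop :=
  has_deriv_halfline g dg /\ {within halfline R, continuous dg}.

(* The measurability part of [integrable] is with respect to Borel sets, i.e.
   h is a Borel representative of its class in L^1_loc. *)
Definition L1loc (R : realType) (h : R -> R) : Prop :=
  forall t : R, 0 <= t ->
    (@lebesgue_measure R).-integrable `[0, t] (fun s => (h s)%:E).

Definition primitive0 (R : realType) (h : R -> R) (t : R) : R :=
  \int[@lebesgue_measure R]_(s in `[0, t]) h s.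

(* Oriented integral from 1 to x of 1 / f. *)
Definition Fint (R : realType) (f : R -> R) (x : R) : R :=
  if 1 <= x then \int[@lebesgue_measure R]_(u in `[1, x]) (f u)^-1
  else - \int[@lebesgue_measure R]_(u in `[x, 1]) (f u)^-1.

Definition abs_cont_on (R : realType) (a b : R) (x : R -> R) : Prop :=
  forall e : R, 0 < e -> exists2 d : R, 0 < d &
    forall (n : nat) (l r : 'I_n -> R),
      (forall i, [/\ a <= l i, l i <= r i & r i <= b]) ->
      (forall i j, i != j -> r i <= l j \/ r j <= l i) ->
      \sum_(i < n) (r i - l i) < d ->
      \sum_(i < n) `|x (r i) - x (l i)| < e.

Definition loc_abs_cont (R : realType) (x : R -> R) : Prop :=
  forall b : R, 0 <= b -> abs_cont_on 0 b x.

Definition total_mass (R : realType)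
    (mu : {measure set (measurableTypeR R) -> \bar R}) : R :=
  fine (mu (halfline R)).

Definition is_solution (R : realType)
    (mu : {measure set (measurableTypeR R) -> \bar R})
    (f h : R -> R) (psi : R) (x : R -> R) : Prop :=
  [/\ loc_abs_cont x,
      (forall t : R, 0 <= t -> 0 <= x t),
      {ae (@lebesgue_measure R), forall t : R, 0 < t ->
         is_derive t 1 x (\int[mu]_(s in `[0, t]) f (x (t - s)) + h t)}
    & x 0 = psi].

Definition asymp_class (R : realType) (f phi dphi : R -> R) : Prop :=
  [/\ C1_halfline phi dphi /\ (forall x : R, 0 <= x -> 0 < phi x),
      (forall x : R, 0 <= x -> 0 < dphi x),
      phi x @[x --> +oo] --> +oo,
      dphi x @[x --> +oo] --> (0 : R)
    & f x / phi x @[x --> +oo] --> (1 : R)].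

Definition nonincr_halfline (R : realType) (g : R -> R) : Prop :=
  forall x y : R, 0 <= x -> x <= y -> g y <= g x.

(* Main.v *)
(* Write M for the total mass of mu, H for the primitive of h, J for that of
   f o H, z = x - H, and F for a primitive of 1 / f.  Since z is locally
   absolutely continuous with z' (t) = G (t), the integral of f (x (t - s)) over
   mu (ds) on [0, t], a.e., and since an absolutely continuous function with
   a.e. nonnegative derivative is nondecreasing, everything reduces to pointwise
   bounds on G, without Fubini's theorem.  Note z is nondecreasing, tends to
   infinity, and x >= z, x >= H.
   - Lower bound: G (t) is at least about M phi (z (t - T)) for a fixed delay T
     carrying almost all the mass.  As phi' -> 0, phi (z (t - T)) is close to
     phi (z (t)) as long as F o z has grown at most linearly over the delay, so
     F o z eventually grows at least as fast as b t for every b < M.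
   - Upper bound: with l > L, x is dominated by the nondecreasing function
     y = z + l M J + C, and y' is at most about (1 + l) M f (y).
   - Third bound: concavity of phi turns H ~ L M J into
     G (t) >= (1 - o(1)) M J' (t - T), hence z >= (1 - o(1)) M J ~ H / L, because
     sublinearity of f makes the delay negligible in J. *)
Require Import Defs.
From mathcomp Require Import all_boot all_order all_algebra.
From mathcomp Require Import all_classical all_reals all_analysis.
From mathcomp Require Import ring lra.

Import Order.TTheory GRing.Theory Num.Theory.
Import numFieldNormedType.Exports.

Local Open Scope classical_set_scope.
Local Open Scope ring_scope.

(** * Absolute continuity, and monotonicity from an a.e. sign of the derivative *)

Section absolute_continuity.
Set Implicit Arguments.
Unset Strict Implicit.
Context {R : realType}.
Implicit Types (a b c t : R) (u v : R -> R).
Local Notation leb := (@lebesgue_measure R).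

(** Compactness of [[a, b]] as Cousin's lemma: at the supremum of the [c] with [P a c], the local
    hypothesis first gives [P a (sup S)], then carries it further unless the supremum is already
    [b]. *)
Lemma cousin (P : R -> R -> Prop) a b : a <= b ->
  (forall r s t, a <= r -> r <= s -> s <= t -> t <= b ->
     P r s -> P s t -> P r t) ->
  (forall t, a <= t -> t <= b -> exists2 d : R, 0 < d &
     forall r s, a <= r -> r <= t -> t <= s -> s <= b ->
       t - d < r -> s < t + d -> P r s) ->
  P a b.
Proof.
move=> ab Ptrans Ploc.
have aPa : P a a.
  have [d d0 h] := Ploc a (lexx _) ab; apply: h => //; lra.
pose S := [set c | [/\ a <= c, c <= b & P a c]].
have Sa : S a by [].
have ubS : ubound S b by move=> c [].
have hS : has_sup S by split; [exists a | exists b].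
have aS : a <= sup S by exact: (sup_upper_bound hS).
have Sb : sup S <= b by apply: ge_sup => //; exists a.
have [d d0 hd] := Ploc _ aS Sb.
have [c [ac cb Pac] dc] := sup_adherent d0 hS.
have cS : c <= sup S by exact: (sup_upper_bound hS).
have PaS : P a (sup S).
  by apply: (Ptrans a c (sup S)) => //; apply: hd => //; lra.
have [Sltb|] := ltP (sup S) b; last first.
  by move=> bS; have <- : sup S = b by apply/le_anti; rewrite Sb bS.
pose w := Num.min b (sup S + d / 2).
have Sw : sup S < w by rewrite lt_min Sltb /=; lra.
have wb : w <= b by rewrite ge_min lexx.
have wS : w <= sup S + d / 2 by rewrite ge_min lexx orbT.
have : S w.
  split => //; first lra.
  apply: (Ptrans a (sup S) w) => //; first lra.
  by apply: hd => //; lra.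
by move/(sup_upper_bound hS); rewrite leNgt Sw.
Qed.

Lemma is_derive_approx u t (D e : R) : is_derive t 1 u D -> 0 < e ->
  exists2 d : R, 0 < d &
    forall y, `|y - t| < d -> `|u y - u t - D * (y - t)| <= e * `|y - t|.
Proof.
move=> [du <-] e0.
have /cvgrPdist_le /(_ e e0) : h^-1 *: (u (h *: 1 + t) - u t) @[h --> 0^'] --> 'D_1 u t.
  exact: du.
case=> d /= d0 hd; exists d => // y ytd.
have [->|yt] := eqVneq y t; first by rewrite !subrr mulr0 subr0 normr0 mulr0.
have yt0 : y - t != 0 by rewrite subr_eq0.
have := hd (y - t).
rewrite /ball /= sub0r normrN => /(_ ytd yt0).
rewrite [_ *: 1]mulr1 subrK => H.
have -> : u y - u t - 'D_1 u t * (y - t) =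
    - (('D_1 u t - (y - t)^-1 *: (u y - u t)) * (y - t)).
  by rewrite [_ *: _]mulrC; field.
by rewrite normrN normrM ler_wpM2r.
Qed.

Lemma trivIset_itv n (l r : 'I_n -> R) :
  (forall i j, i != j -> r i <= l j \/ r j <= l i) ->
  trivIset setT (fun i => `]l i, r i[%classic).
Proof.
move=> dis; apply/trivIsetP => i j _ _ ij; rewrite -subset0 => y [] /=.
rewrite !in_itv /= => /andP[h1 h2] /andP[h3 h4].
by case: (dis i j ij) => h; lra.
Qed.

Lemma lebesgue_measure_bigsetU_itv n (l r : 'I_n -> R) :
  (forall i, l i <= r i) ->
  (forall i j, i != j -> r i <= l j \/ r j <= l i) ->
  leb (\big[setU/set0]_(i < n) `]l i, r i[%classic) =
  (\sum_(i < n) (r i - l i))%:E.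
Proof.
move=> lr dis.
have mF i : measurable (`]l i, r i[%classic : set R) by exact: measurable_itv.
rewrite (@measure_bigsetU_ord _ _ _ leb n xpredT _ mF (trivIset_itv dis)).
rewrite -sumEFin; apply: eq_bigr => i _.
transitivity (leb `]l i, r i[) => //.
rewrite lebesgue_measure_itv /= lte_fin.
by case: ltgtP (lr i) => // -> _; rewrite subrr.
Qed.

Lemma sum_itv_le_measure (U : set R) n (l r : 'I_n -> R) : measurable U ->
  (forall i, l i <= r i) -> (forall i, `]l i, r i[%classic `<=` U) ->
  (forall i j, i != j -> r i <= l j \/ r j <= l i) ->
  ((\sum_(i < n) (r i - l i))%:E <= leb U)%E.
Proof.
move=> mU lr sub dis; rewrite -(lebesgue_measure_bigsetU_itv lr dis).
apply: le_measure; [apply/mem_set|exact/mem_set|].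
  by apply: bigsetU_measurable => i _; exact: measurable_itv.
apply: (big_ind (fun A => A `<=` U)) => [//|A B AU BU y|i _]; last exact: sub.
by case=> [/AU|/BU].
Qed.

(* Each point of [[a, b]] has a neighbourhood on which [u] almost does not
   decrease, or, near the exceptional null set, one contained in an open set
   [U] of small measure; Cousin's lemma glues these, and absolute continuity
   bounds the variation of [u] along the intervals contained in [U]. *)
Lemma abs_cont_nondecreasing a b u : a <= b -> abs_cont_on a b u ->
  {ae leb, forall t, a < t -> t < b -> exists2 D, 0 <= D & is_derive t 1 u D} ->
  u a <= u b.
Proof.
move=> ab acu aeu; apply/ler_addgt0Pr => e e0.
(* Slope whose total loss over [[a, b]] is at most [e / 2]; the [+ 1] covers [a = b]. *)
pose e1 := e / (2 * (b - a + 1)).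
have ba : 0 < 2 * (b - a + 1) by lra.
have e10 : 0 < e1 by rewrite divr_gt0.
have e1ba : e1 * (b - a) <= e / 2.
  rewrite /e1 mulrAC ler_pdivrMr //.
  have : 0 <= e * (b - a) by rewrite mulr_ge0 //; lra.
  nra.
have e20 : 0 < e / 2 by lra.
have [d d0 hd] := acu _ e20.
have null1 c : leb.-negligible [set c].
  by exists [set c]; split => //; exact: lebesgue_measure_set1.
(* The endpoints join the exceptional set, as the derivative is only known in the open interval. *)
have [N [mN N0 hN]] := negligibleU (negligibleU aeu (null1 a)) (null1 b).
have [|U [oU NU Ud]] := @lebesgue_regularity_outer R N d mN _ d0.
  by rewrite [X in (X < _)%E]N0 ltry.
have mU : measurable U by exact: measurable_realfun.open_measurable.
have {}Ud : (leb U < d%:E)%E.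
  rewrite -(setDUK NU).
  apply: le_lt_trans (measureU2 leb mN (measurableD mU mN)) _.
  by rewrite [X in (X + _)%E]N0 add0e.
(* A certificate for [[r, s]]: [u] decreases by at most slope [e1] plus its variation along finitely
   many disjoint intervals inside [U]. Certificates of adjacent intervals concatenate. *)
pose P r s := exists n (l m : 'I_n -> R),
  [/\ forall i, [/\ r <= l i, l i <= m i & m i <= s],
      forall i, `]l i, m i[%classic `<=` U,
      forall i j, i != j -> m i <= l j \/ m j <= l i
    & u r - u s <= e1 * (s - r) + \sum_(i < n) `|u (m i) - u (l i)|].
suff [n [l [m [lm sub dis le]]]] : P a b.
  have := hd n l m lm dis.
  have : ((\sum_(i < n) (m i - l i))%:E < d%:E)%E.
    apply: le_lt_trans Ud; apply: sum_itv_le_measure => // i.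
    by have [] := lm i.
  rewrite lte_fin => h /(_ h) h2; lra.
apply: cousin => // [r s t ar rs st tb|t ta tb].
  move=> [n1 [l1 [m1 [lm1 sub1 dis1 le1]]]] [n2 [l2 [m2 [lm2 sub2 dis2 le2]]]].
  exists (n1 + n2)%N.
  exists (fun i => match fintype.split i with inl j => l1 j | inr j => l2 j end).
  exists (fun i => match fintype.split i with inl j => m1 j | inr j => m2 j end).
  split.
  - move=> i; case: split_ordP => j _.
      by have [] := lm1 j; split => //; lra.
    by have [] := lm2 j; split => //; lra.
  - by move=> i; case: split_ordP => j _; [exact: sub1|exact: sub2].
  - move=> i j; case: split_ordP => i' ->; case: split_ordP => j' -> ij.
    + by apply: dis1; apply: contraNN ij => /eqP ->.
    + by left; have [? ? ?] := lm1 i'; have [? ? ?] := lm2 j'; lra.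
    + by right; have [? ? ?] := lm2 i'; have [? ? ?] := lm1 j'; lra.
    + by apply: dis2; apply: contraNN ij => /eqP ->.
  - rewrite big_split_ord /=.
    rewrite (eq_bigr (fun i => `|u (m1 i) - u (l1 i)|)); last first.
      move=> i _; case: split_ordP => j; first by move/lshift_inj => ->.
      by move=> /(congr1 val) /= h; have := ltn_ord i; rewrite h ltnNge leq_addr.
    rewrite [X in _ <= _ + (_ + X)](eq_bigr (fun i => `|u (m2 i) - u (l2 i)|)).
      have -> : e1 * (t - r) = e1 * (s - r) + e1 * (t - s) by ring.
      lra.
    move=> i _; case: split_ordP => j; last by move/rshift_inj => ->.
    by move=> /(congr1 val) /= h; have := ltn_ord j; rewrite -h ltnNge leq_addr.
have [tN|tN] := pselect (N t).
  have : open_nbhs t U by split => //; exact: NU.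
  move/open_nbhs_nbhs/nbhs_ballP => [d' /= d'0 dU].
  exists d' => // r s ar rt ts sb dr sd.
  exists 1%N, (fun=> r), (fun=> s); split => [_|_ y||].
  - by split; lra.
  - by rewrite /= in_itv /= => /andP[ry ys]; apply: dU; rewrite /ball /= ltr_distl; lra.
  - by move=> i j; rewrite !ord1.
  - rewrite big_ord1.
    have : 0 <= e1 * (s - r) by rewrite mulr_ge0; lra.
    have := ler_norm (u r - u s); rewrite distrC; lra.
have [D D0 du] : exists2 D, 0 <= D & is_derive t 1 u D.
  have {}tN := contra_not (hN t) tN.
  have [ta'|ta'] := eqVneq t a; first by case: tN; left; right.
  have [tb'|tb'] := eqVneq t b; first by case: tN; right.
  apply: contrapT => h; apply: tN; left; left => /= h'; apply: h.
  by apply: h'; rewrite lt_neqAle ?tb ?tb' // eq_sym ta' ta.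
have [d1 d10 hd1] := is_derive_approx du e10.
exists d1 => // r s ar rt ts sb dr sd.
exists 0%N, (fun=> 0), (fun=> 0); split; try by case.
rewrite big_ord0 addr0.
have /hd1 : `|r - t| < d1 by rewrite ler0_norm; lra.
rewrite (ler0_norm (_ : r - t <= 0)); last lra.
rewrite ler_norml => /andP[_ hr].
have /hd1 : `|s - t| < d1 by rewrite ger0_norm; lra.
rewrite (ger0_norm (_ : 0 <= s - t)); last lra.
rewrite ler_norml => /andP[hs _].
have : 0 <= D * (s - t) by rewrite mulr_ge0 //; lra.
have : D * (r - t) <= 0 by rewrite mulr_ge0_le0 //; lra.
lra.
Qed.

Lemma abs_cont_on_sub a b c d u : a <= c -> d <= b ->
  abs_cont_on a b u -> abs_cont_on c d u.
Proof.
move=> ac db acu e /acu[k k0 hk]; exists k => // n l r lr; apply: hk => i.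
by have [? ? ?] := lr i; split => //; lra.
Qed.

Lemma abs_cont_on_axpy a b k u v : abs_cont_on a b u -> abs_cont_on a b v ->
  abs_cont_on a b (fun t => u t + k * v t).
Proof.
move=> acu acv e e0.
have k1 : 0 < `|k| + 1 by have := normr_ge0 k; lra.
have [|d1 d10 h1] := acu (e / 2); first lra.
have [|d2 d20 h2] := acv (e / 2 / (`|k| + 1)); first by rewrite divr_gt0 //; lra.
exists (Num.min d1 d2) => [|n l r lr dis]; first by rewrite lt_min d10.
rewrite lt_min => /andP[/(h1 _ _ _ lr dis) s1 /(h2 _ _ _ lr dis) s2].
apply: (@le_lt_trans _ _ (\sum_(i < n) `|u (r i) - u (l i)| +
   `|k| * \sum_(i < n) `|v (r i) - v (l i)|)).
  rewrite mulr_sumr -big_split /=; apply: ler_sum => i _; rewrite -normrM.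
  rewrite [X in `|X| <= _](_ : _ =
    u (r i) - u (l i) + k * (v (r i) - v (l i))); last by ring.
  exact: ler_normD.
move: s2; rewrite ltr_pdivlMr // => s2.
have : 0 <= \sum_(i < n) `|v (r i) - v (l i)| by exact: sumr_ge0.
lra.
Qed.

Lemma lipschitz_abs_cont_on a b K u :
  (forall s t, a <= s -> s <= t -> t <= b -> `|u t - u s| <= K * (t - s)) ->
  abs_cont_on a b u.
Proof.
move=> uK e e0.
have k1 : 0 < `|K| + 1 by have := normr_ge0 K; lra.
exists (e / (`|K| + 1)) => [|n l r lr _]; first by rewrite divr_gt0.
rewrite ltr_pdivlMr // => h; apply: le_lt_trans h.
rewrite mulr_suml; apply: ler_sum => i _; have [h1 h2 h3] := lr i.
apply: le_trans (uK _ _ h1 h2 h3) _; rewrite mulrC ler_wpM2l //; first lra.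
by have := ler_norm K; lra.
Qed.

Lemma lipschitz_comp_abs_cont_on a b K (F : R -> R) u :
  (forall s t, a <= s -> s <= b -> a <= t -> t <= b ->
     `|F (u t) - F (u s)| <= K * `|u t - u s|) ->
  abs_cont_on a b u -> abs_cont_on a b (F \o u).
Proof.
move=> FK acu e e0.
have k1 : 0 < `|K| + 1 by have := normr_ge0 K; lra.
have [|d d0 hd] := acu (e / (`|K| + 1)); first by rewrite divr_gt0.
exists d => // n l r lr dis /(hd _ _ _ lr dis).
rewrite ltr_pdivlMr // => h; apply: le_lt_trans h.
rewrite mulr_suml; apply: ler_sum => i _; have [h1 h2 h3] := lr i.
apply: le_trans (FK (l i) (r i) _ _ _ _) _; try lra.
rewrite mulrC ler_wpM2l //; by have := ler_norm K; lra.
Qed.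

Lemma abs_cont_on_shift a b c u : abs_cont_on (a - c) (b - c) u ->
  abs_cont_on a b (fun t => u (t - c)).
Proof.
move=> acu e /acu[d d0 hd]; exists d => // n l r lr dis lrd.
apply: (hd n (fun i => l i - c) (fun i => r i - c)).
- by move=> i; have [? ? ?] := lr i; split; lra.
- by move=> i j /dis [?|?]; [left|right]; lra.
- by apply: le_lt_trans lrd; apply: ler_sum => i _; lra.
Qed.

Lemma abs_cont_on_continuous a b u t : abs_cont_on a b u ->
  a <= t -> t <= b -> forall e, 0 < e -> exists2 d : R, 0 < d &
    forall s, a <= s -> s <= b -> `|s - t| < d -> `|u s - u t| < e.
Proof.
move=> acu at' tb e /acu[d d0 hd]; exists d => // s as' sb.
have [st|ts] := leP s t => std.
  rewrite distrC.
  have := hd 1%N (fun=> s) (fun=> t); rewrite !big_ord1; apply => //.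
  - by move=> i j; rewrite !ord1.
  - by rewrite ler0_norm in std; lra.
have := hd 1%N (fun=> t) (fun=> s); rewrite !big_ord1; apply => //.
- by move=> _; split => //; lra.
- by move=> i j; rewrite !ord1.
- by rewrite ger0_norm in std; lra.
Qed.

Lemma ae_leb_imp (P Q : R -> Prop) : (forall t, P t -> Q t) ->
  {ae leb, forall t, P t} -> {ae leb, forall t, Q t}.
Proof. exact: (@filterS _ _ (ae_filter_ringOfSetsType leb)). Qed.

Lemma ae_leb_imp2 (P Q S : R -> Prop) : (forall t, P t -> Q t -> S t) ->
  {ae leb, forall t, P t} -> {ae leb, forall t, Q t} -> {ae leb, forall t, S t}.
Proof. exact: (@filterS2 _ _ (ae_filter_ringOfSetsType leb)). Qed.

(** The derivative is asked only in the open interval, so one-sided behaviour at the endpoints never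
    matters. *)
Definition ac_deriv a b u v := abs_cont_on a b u /\
  {ae leb, forall t, a < t -> t < b -> is_derive t 1 u (v t)}.

Lemma ac_deriv_le a b u v : a <= b -> ac_deriv a b u v ->
  (forall t, a < t -> t < b -> 0 <= v t) -> u a <= u b.
Proof.
move=> ab [acu du] v0; apply: abs_cont_nondecreasing acu _ => //.
apply: ae_leb_imp du => t du at' tb; exists (v t); [exact: v0|exact: du].
Qed.

Lemma ac_deriv_sub a b c d u v : a <= c -> d <= b ->
  ac_deriv a b u v -> ac_deriv c d u v.
Proof.
move=> ac db [acu du]; split; first exact: abs_cont_on_sub acu.
by apply: ae_leb_imp du => t h ct td; apply: h; lra.
Qed.

Lemma is_derive_axpy k u v t (du dv : R) : is_derive t 1 u du ->
  is_derive t 1 v dv -> is_derive t 1 (fun t => u t + k * v t) (du + k * dv).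
Proof. by move=> hu hv; exact: (is_deriveD hu (is_deriveZ k hv)). Qed.

Lemma ac_deriv_axpy a b k u v du dv : ac_deriv a b u du -> ac_deriv a b v dv ->
  ac_deriv a b (fun t => u t + k * v t) (fun t => du t + k * dv t).
Proof.
move=> [acu hu] [acv hv]; split; first exact: abs_cont_on_axpy.
apply: ae_leb_imp2 hu hv => t hu hv at' tb; apply: is_derive_axpy; auto.
Qed.

Lemma ac_deriv_id a b : ac_deriv a b id (cst 1).
Proof.
split; last by apply: aeW => t _ _; exact: is_derive_id.
apply: (@lipschitz_abs_cont_on _ _ 1) => s t _ st _.
by rewrite mul1r ger0_norm //; lra.
Qed.

(** [F] is differentiable at every value of [u], so the chain rule holds wherever [u] has a
    derivative and no null set is pulled back; the Lipschitz bound preserves absolute continuity. *)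
Lemma ac_deriv_comp a b c K (F dF : R -> R) u v :
  (forall y y', c <= y -> y <= y' -> `|F y' - F y| <= K * (y' - y)) ->
  (forall y, c <= y -> is_derive y 1 F (dF y)) ->
  (forall t, a <= t -> t <= b -> c <= u t) ->
  ac_deriv a b u v -> ac_deriv a b (F \o u) (fun t => dF (u t) * v t).
Proof.
move=> FK dFE cu [acu du]; split.
  apply: (lipschitz_comp_abs_cont_on (K := K)) acu => s t as' sb at' tb.
  have [st|ts] := leP (u s) (u t).
    by rewrite (ger0_norm (_ : 0 <= u t - u s)); [apply: FK => //; exact: cu|lra].
  rewrite distrC (ler0_norm (_ : u t - u s <= 0)); last lra.
  by rewrite opprB; apply: FK; [exact: cu|lra].
apply: ae_leb_imp du => t du at' tb.
by apply: is_derive1_comp; [apply: dFE; apply: cu; lra|exact: du].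
Qed.

(** * Primitives of continuous and of locally integrable functions *)

Lemma halfline_segment_continuous (g : R -> R) a b : 0 <= a ->
  {within halfline R, continuous g} -> {within `[a, b], continuous g}.
Proof.
move=> a0; have sub : `[a, b]%classic `<=` halfline R.
  by move=> t; rewrite /halfline /= !in_itv /= andbT => /andP[/(le_trans a0)].
exact: continuous_subspaceW.
Qed.

Lemma halfline_continuous_at (g : R -> R) t :
  {within halfline R, continuous g} -> 0 < t -> {for t, continuous g}.
Proof.
move=> /(@halfline_segment_continuous _ 0 (t + 1) (lexx _)) cg t0.
have h : 0 < t + 1 by lra.
by apply: (within_continuous_continuous h cg); rewrite in_itv /= t0 ltrDl ltr01.
Qed.

Lemma halfline_continuous_L1loc (g : R -> R) :
  {within halfline R, continuous g} -> L1loc g.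
Proof.
move=> cg t t0; apply: continuous_compact_integrable; first exact: segment_compact.
exact: halfline_segment_continuous.
Qed.

Lemma is_derive_primitive0 (g : R -> R) t :
  {within halfline R, continuous g} -> 0 < t ->
  is_derive t 1 (primitive0 g) (g t).
Proof.
move=> cg t0; have tt : t < t + 1 by lra.
have ig : leb.-integrable `[0, t + 1] (EFin \o g).
  by apply: halfline_continuous_L1loc => //; lra.
have [dg <-] := continuous_FTC1 tt ig (a := BLeft 0) t0 (halfline_continuous_at cg t0).
by apply: DeriveDef => //; rewrite derive1E.
Qed.

Lemma primitive0_0 (h : R -> R) : primitive0 h 0 = 0.
Proof. by rewrite /primitive0 set_itv1 Rintegral_set1. Qed.

Lemma primitive0_diff_le (h : R -> R) b r s : L1loc h -> 0 <= r -> r <= s -> s <= b ->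
  `|primitive0 h s - primitive0 h r| <= \int[leb]_(t in `]r, s[) `|h t|.
Proof.
move=> hh r0 rs sb.
have ih : leb.-integrable `[0, s] (EFin \o h) by apply: hh; lra.
have ih' : leb.-integrable `]r, s] (EFin \o h).
  by apply: integrableS ih => // t; rewrite /= !in_itv /= => /andP[]; lra.
rewrite /primitive0 Rintegral_itvB //.
apply: le_trans (le_normr_Rintegral _ _) _ => //.
rewrite -Rintegral_itv_bndo_bndc //.
have : leb.-integrable `]r, s] (EFin \o (fun t => `|h t|)) by exact: integrable_norm.
by apply: integrableS => // t; rewrite /= !in_itv /= => /andP[]; lra.
Qed.

(** Absolute continuity of the integral of [|h|] over sets of small measure, applied to the union of
    the intervals; [h] is cut off outside [[0, b]] to be integrable on the line. *)
Lemma abs_cont_on_primitive0 (h : R -> R) b : L1loc h -> 0 <= b ->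
  abs_cont_on 0 b (primitive0 h).
Proof.
move=> hh b0 e e0.
pose g := h \_ `[0, b].
have ig : leb.-integrable setT (EFin \o g).
  rewrite /g -restrict_EFin.
  by apply: (iffLR (integrable_mkcond _ _)) => //; exact: hh.
have [d [d0 hd]] := integral_normr_continuous ig e0.
exists d => // n l r lr dis lrd.
pose F i := `]l i, r i[%classic.
have mF i : measurable (F i) by exact: measurable_itv.
have mD : measurable (\big[setU/set0]_(i < n) F i).
  by apply: bigsetU_measurable => i _; exact: mF.
have lr' i : l i <= r i by have [] := lr i.
have := hd _ mD; rewrite [X in (X < _)%E](lebesgue_measure_bigsetU_itv lr' dis).
rewrite lte_fin => /(_ lrd); apply: le_lt_trans.
have ign A : measurable A -> leb.-integrable A (EFin \o (fun t => `|g t|)).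
  move=> mA; apply: (@integrableS _ _ _ _ setT) => //; exact: integrable_norm.
rewrite -lee_fin -sumEFin /Rintegral fineK; last first.
  by apply: integrable_fin_num => //; exact: ign.
rewrite (@integral_bigsetU_EFin _ _ _ leb _ F _ (index_enum 'I_n)) //.
- apply: lee_sum => i _; rewrite -[leRHS]fineK; last first.
    by apply: integrable_fin_num; [exact: mF|exact: (ign (F i) (mF i))].
  rewrite lee_fin; have [l0 lri rb] := lr i.
  apply: le_trans (primitive0_diff_le hh l0 lri rb) _.
  rewrite le_eqVlt; apply/orP; left; apply/eqP; apply: eq_Rintegral => t.
  rewrite inE /F /= in_itv /= => /andP[lt tr]; rewrite /g patchE mem_set //=.
  by rewrite in_itv /=; lra.
- exact: index_enum_uniq.
- by apply: sub_trivIset (trivIset_itv dis).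
- exact: (measurable_int _ (ign _ mD)).
Qed.

Lemma ac_deriv_primitive0 (h : R -> R) b : L1loc h -> 0 <= b ->
  ac_deriv 0 b (primitive0 h) h.
Proof.
move=> hh b0; split; first exact: abs_cont_on_primitive0.
pose g := h \_ `[0, b].
have ih : leb.-integrable `[0, b] (EFin \o h) by exact: hh.
have locg : locally_integrable setT g by exact: integrable_locally.
have ig y : leb.-integrable `[0, y] (EFin \o g).
  apply: (@integrableS _ _ _ _ setT) => //.
  rewrite /g -restrict_EFin.
  exact: (iffLR (integrable_mkcond _ _)).
apply: ae_leb_imp (FTC1 (a := BLeft 0) ig locg) => t + t0 tb.
move=> /(_ _)[|dg gE]; first by rewrite lte_fin.
have gh s : 0 <= s -> s <= b -> g s = h s.
  by move=> s0 sb; rewrite /g patchE mem_set //= in_itv /= s0 sb.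
rewrite -gh ?ltW //.
(* The primitives of [h] and of its cut-off [g] agree near [t] because [t < b]. *)
apply: (@near_eq_is_derive _ _ _ (primitive0 g)); last first.
  by apply: DeriveDef => //; rewrite -gE derive1E.
apply/nbhs_ballP; exists (b - t) => [|s]; rewrite /= ?subr_gt0 // /ball /=.
rewrite ltr_distlC => /andP[_ sb]; apply: eq_Rintegral => y.
rewrite inE /= in_itv /= => /andP[y0 ys]; apply: gh => //; lra.
Qed.

Lemma ac_deriv_linear a b k : ac_deriv a b (fun t => k * t) (cst k).
Proof.
split.
  apply: (@lipschitz_abs_cont_on _ _ `|k|) => s t _ st _.
  by rewrite -mulrBr normrM (ger0_norm (_ : 0 <= t - s)) //; lra.
apply: aeW => t _ _; have := is_deriveZ k (is_derive_id t (1 : R)).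
by rewrite [_ *: 1]mulr1.
Qed.

Lemma ac_deriv_cst a b k : ac_deriv a b (cst k) (cst 0).
Proof.
split; last by apply: aeW => t _ _; exact: is_derive_cst.
apply: (@lipschitz_abs_cont_on _ _ 0) => s t _ _ _.
by rewrite subrr normr0 mul0r.
Qed.

End absolute_continuity.

(** * Continuity and differentiability on the half-line *)

Section halfline.
Set Implicit Arguments.
Unset Strict Implicit.
Context {R : realType}.
Implicit Types (f g u v : R -> R) (s t y : R).

Lemma halfline_continuousP g : {within halfline R, continuous g} <->
  (forall t, 0 <= t -> forall e, 0 < e -> exists2 d : R, 0 < d &
     forall s, 0 <= s -> `|s - t| < d -> `|g s - g t| < e).
Proof.
split=> [/subspace_continuousP cg t t0 e e0|cg].
  have ht : halfline R t by rewrite /halfline /= in_itv /= t0.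
  have /cvgrPdist_lt /(_ e e0) [d /= d0 hd] := cg t ht.
  exists d => // s s0 std; rewrite distrC; apply: hd; rewrite /= 1?distrC //.
  by rewrite /halfline /= in_itv /= s0.
apply/subspace_continuousP => t; rewrite /halfline /= in_itv /= andbT => t0.
apply/cvgrPdist_lt => e e0; have [d d0 hd] := cg t t0 e e0.
exists d => //= s std; rewrite in_itv /= andbT => s0.
by rewrite distrC; apply: hd => //; rewrite distrC.
Qed.

Lemma halfline_continuous_comp g u : {within halfline R, continuous g} ->
  {within halfline R, continuous u} -> (forall t, 0 <= t -> 0 <= u t) ->
  {within halfline R, continuous (g \o u)}.
Proof.
move=> /halfline_continuousP cg /halfline_continuousP cu u0.
apply/halfline_continuousP => t t0 e e0.
have [d d0 hd] := cg _ (u0 _ t0) _ e0; have [d' d'0 hd'] := cu _ t0 _ d0.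
by exists d' => // s s0 /(hd' _ s0) h; apply: hd => //; exact: u0.
Qed.

Lemma halfline_continuousV f : cont_pos f ->
  {within halfline R, continuous (fun y => (f y)^-1)}.
Proof.
move=> [/subspace_continuousP cf f0]; apply/subspace_continuousP => t ht.
apply: cvgV; last exact: cf.
by rewrite gt_eqF // f0 //; move: ht; rewrite /halfline /= in_itv /= andbT.
Qed.

Lemma loc_abs_cont_continuous u : loc_abs_cont u ->
  {within halfline R, continuous u}.
Proof.
move=> acu; apply/halfline_continuousP => t t0 e e0.
have t1 : 0 <= t + 1 by lra.
have tt : t <= t + 1 by lra.
have [d d0 hd] := abs_cont_on_continuous (acu _ t1) t0 tt e0.
exists (Num.min d 1) => [|s s0]; first by rewrite lt_min d0 ltr01.
rewrite lt_min => /andP[sd]; rewrite ltr_distl => /andP[_ s1].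
by apply: hd => //; lra.
Qed.

Lemma continuous_bounded f X : {within halfline R, continuous f} -> 0 <= X ->
  exists2 C, 0 < C & forall y, 0 <= y -> y <= X -> f y <= C.
Proof.
move=> cf X0; have cf' := @halfline_segment_continuous _ f 0 X (lexx _) cf.
have [c _ hc] := EVT_max X0 cf'.
exists (`|f c| + 1) => [|y y0 yX]; first by have := normr_ge0 (f c); lra.
have := hc y; rewrite in_itv /= y0 yX => /(_ isT).
by have := ler_norm (f c); lra.
Qed.

Lemma near_pinfty_ex (P : R -> Prop) : (\forall y \near +oo, P y) ->
  exists2 X, 0 < X & forall y, X <= y -> P y.
Proof.
move=> [M [_ hM]]; exists (`|M| + 1) => [|y My].
  by have := normr_ge0 M; lra.
by apply: hM; have := ler_norm M; lra.
Qed.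

Lemma is_derive_eps u t (D : R) :
  (forall e, 0 < e -> exists2 d : R, 0 < d & forall y, `|y - t| < d -> y != t ->
     `|D - (u y - u t) / (y - t)| <= e) -> is_derive t 1 u D.
Proof.
move=> H.
have cvD : h^-1 *: (u (h *: 1 + t) - u t) @[h --> 0^'] --> D.
  apply/cvgrPdist_le => e /H[d d0 hd]; exists d => //= h.
  rewrite /ball_ /= sub0r normrN => hd0 h0; have := hd (h + t).
  by rewrite addrK -subr_eq0 addrK => /(_ hd0 h0); rewrite mulrC [_ *: 1]mulr1.
apply: DeriveDef; first by apply/cvg_ex; exists D.
by apply/cvg_lim => //; exact: Rhausdorff.
Qed.

Lemma nondecreasing_is_derive u v s t : s <= t ->
  (forall y, s <= y -> y <= t -> is_derive y 1 u (v y)) ->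
  (forall y, s <= y -> y <= t -> 0 <= v y) -> u s <= u t.
Proof.
move=> st du v0.
have [y||c] := @MVT_segment R u v s t st.
- by rewrite in_itv /= => /andP[? ?]; apply: du; lra.
- apply: derivable_within_continuous => y; rewrite in_itv /= => /andP[? ?].
  by apply: ex_derive; apply: du.
- rewrite in_itv /= => /andP[sc ct] E.
  have : 0 <= v c * (t - s) by rewrite mulr_ge0 ?v0 // subr_ge0.
  by rewrite -E subr_ge0.
Qed.

End halfline.

(** * Asymptotic properties of [f] and [phi] *)

Section asymptotics.
Set Implicit Arguments.
Unset Strict Implicit.
Context {R : realType} (f phi dphi : R -> R).
Implicit Types (k s t y X : R).
Hypothesis hf : cont_pos f.
Hypothesis hphi : asymp_class f phi dphi.

Let f_gt0 y : 0 <= y -> 0 < f y. Proof. by case: hf => _; apply. Qed.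
Let phi_gt0 y : 0 <= y -> 0 < phi y. Proof. by case: hphi => -[_]; auto. Qed.
Let dphi_gt0 y : 0 <= y -> 0 < dphi y. Proof. by case: hphi; auto. Qed.

Lemma asymp_class_is_derive y : 0 < y -> is_derive y 1 phi (dphi y).
Proof.
move=> y0; case: hphi => -[[dE _] _] _ _ _ _; apply: is_derive_eps => e e0.
have /cvgrPdist_le /(_ e e0) [d /= d0 hd] := dE y (ltW y0).
(* Points within distance [y] of [y] stay in R^+, so there the relative quotient is the two-sided
   one. *)
exists (Num.min d y) => [|t]; first by rewrite lt_min d0.
rewrite lt_min => /andP[td ty] ny; apply: hd; rewrite /= 1?distrC //.
by rewrite /halfline /= in_itv /= andbT; move: ty; rewrite ltr_distlC; lra.
Qed.

Lemma asymp_class_nondecreasing s t : 0 < s -> s <= t -> phi s <= phi t.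
Proof.
move=> s0 st; apply: (@nondecreasing_is_derive _ phi dphi) => // y sy yt.
  by apply: asymp_class_is_derive; lra.
by apply/ltW/dphi_gt0; lra.
Qed.

Lemma asymp_class_large K : exists2 X, 0 < X & forall y, X <= y -> K <= phi y.
Proof.
apply: near_pinfty_ex; case: hphi => _ _ h _ _.
exact: (iffLR (cvgryPge phi) h).
Qed.

Lemma asymp_class_deriv_small e : 0 < e ->
  exists2 X, 0 < X & forall y, X <= y -> dphi y <= e.
Proof.
move=> e0; case: hphi => _ _ _ /cvgrPdist_le /(_ e e0) h _.
have [X X0 hX] := near_pinfty_ex h; exists X => // y /hX.
by rewrite sub0r normrN; apply: le_trans; exact: ler_norm.
Qed.

(** If [f / phi] is within [1 - k] of 1 then [f <= (2 - k) phi], and [k (2 - k) <= 1]. One constant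
    [k] thus serves both directions, and later losses are counted as powers of [k]. *)
Lemma asymp_class_equiv k : 0 < k -> k < 1 -> exists2 X, 0 < X &
  forall y, X <= y -> k * phi y <= f y /\ k * f y <= phi y.
Proof.
move=> k0 k1; case: hphi => _ _ _ _ /cvgrPdist_le h.
have /h{}h : 0 < 1 - k by lra.
have [X X0 hX] := near_pinfty_ex h; exists X => // y Xy.
have y0 : 0 <= y by lra.
have p0 := phi_gt0 y0; have := hX y Xy; rewrite ler_distlC => /andP[].
rewrite ler_pdivlMr // ler_pdivrMr // => h1 h2; split; nra.
Qed.

Lemma asymp_class_sublinear e : 0 < e ->
  exists2 X, 0 < X & forall y, X <= y -> phi y <= e * y.
Proof.
move=> e0; have [|X X0 hX] := @asymp_class_deriv_small (e / 2); first lra.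
(* Beyond [X], [phi] grows with slope at most [e / 2]; the second term makes [phi X] at most
   [e / 2 * y]. *)
exists (X + 2 * phi X / e) => [|y Xy].
  by rewrite addr_gt0 // divr_gt0 // mulr_gt0 // phi_gt0 // ltW.
have p0 : 0 < 2 * phi X / e by rewrite divr_gt0 // mulr_gt0 // phi_gt0 // ltW.
have Xy' : X <= y by lra.
have : e / 2 * X + (-1) * phi X <= e / 2 * y + (-1) * phi y.
  apply: (@nondecreasing_is_derive _ (fun s => e / 2 * s + (-1) * phi s)
    (fun s => e / 2 + (-1) * dphi s)) => // s Xs sy.
    apply: is_derive_axpy; last by apply: asymp_class_is_derive; lra.
    have := is_deriveZ (e / 2) (is_derive_id s (1 : R)).
    by rewrite [_ *: 1]mulr1.
  by have := hX s Xs; lra.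
have : 2 * phi X / e <= y by lra.
by rewrite ler_pdivrMr //; nra.
Qed.

Lemma asymp_class_sublinear_f e : 0 < e ->
  exists2 X, 0 < X & forall y, X <= y -> f y <= e * y.
Proof.
move=> e0; have [|X1 X10 h1] := @asymp_class_sublinear (e / 2); first lra.
have [| |X2 X20 h2] := @asymp_class_equiv (1 / 2); try lra.
exists (X1 + X2) => [|y Xy]; first lra.
have := h1 y; have [|_] := h2 y; lra.
Qed.

(** A minimum on a compact interval, and [f >= phi / 2 >= 1] beyond it. This bound makes the
    primitive of [1 / f] Lipschitz and forces at least linear growth of [J] and [z]. *)
Lemma asymp_class_lower_bound : exists2 c, 0 < c & forall y, 0 <= y -> c <= f y.
Proof.
have [X1 X10 h1] := asymp_class_large 2.
have [| |X2 X20 h2] := @asymp_class_equiv (1 / 2); try lra.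
have X0 : 0 <= X1 + X2 by lra.
have cf' := @halfline_segment_continuous _ f 0 (X1 + X2) (lexx _) hf.1.
have [c + hc] := EVT_min X0 cf'; rewrite in_itv /= => /andP[c0 _].
exists (Num.min (f c) 1) => [|y y0]; first by rewrite lt_min ltr01 f_gt0.
have [yX|Xy] := leP y (X1 + X2).
  by rewrite ge_min hc // in_itv /= y0.
rewrite ge_min; apply/orP; right.
have := h1 y; have [|] := h2 y; lra.
Qed.

(* Concavity gives [l y phi'(l y) <= phi (l y)], whence
   [phi y - phi (l y) <= (1 - l) / l * phi (l y)]. *)
Lemma concave_dilation l y : nonincr_halfline dphi -> 0 < l -> l < 1 -> 0 < y ->
  l * phi y <= phi (l * y).
Proof.
move=> ni l0 l1 y0; set w := l * y.
have w0 : 0 < w by rewrite mulr_gt0.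
have wy : w <= y by rewrite /w; nra.
have dw := dphi_gt0 (ltW w0).
have wdw : w * dphi w <= phi w.
  (* The tangent bound is taken from a small [s > 0], since [phi] has a two-sided derivative only at
     positive points; [s] costs at most [e]. *)
  apply/ler_addgt0Pr => e e0; pose s := Num.min w (e / dphi w).
  have s0 : 0 < s by rewrite lt_min w0 divr_gt0.
  have sw : s <= w by rewrite ge_min lexx.
  have se : dphi w * s <= e.
    by rewrite mulrC -ler_pdivlMr // ge_min lexx orbT.
  have : phi s + (- dphi w) * s <= phi w + (- dphi w) * w.
    apply: (@nondecreasing_is_derive _ (fun t => phi t + (- dphi w) * t)
      (fun t => dphi t + (- dphi w) * 1)) => // t st tw.
      by apply: is_derive_axpy; apply: asymp_class_is_derive; lra.
    by have := ni t w; lra.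
  by have := phi_gt0 (ltW s0); lra.
have : dphi w * w + (-1) * phi w <= dphi w * y + (-1) * phi y.
  apply: (@nondecreasing_is_derive _ (fun t => dphi w * t + (-1) * phi t)
    (fun t => dphi w + (-1) * dphi t)) => // t wt ty.
    apply: is_derive_axpy; last by apply: asymp_class_is_derive; lra.
    have := is_deriveZ (dphi w) (is_derive_id t (1 : R)).
    by rewrite [_ *: 1]mulr1.
  by have := ni w t; lra.
move=> h; have : l * (dphi w * y + -1 * phi y) >= l * (dphi w * w + -1 * phi w).
  by rewrite ler_wpM2l // ltW.
have -> : l * (dphi w * y + -1 * phi y) = w * dphi w - l * phi y.
  by rewrite /w; ring.
have : 0 <= (1 - l) * (phi w - w * dphi w) by rewrite mulr_ge0 //; lra.
lra.
Qed.

End asymptotics.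

(** * The primitive of [1 / f] *)

Section inverse_primitive.
Set Implicit Arguments.
Unset Strict Implicit.
Context {R : realType} (f : R -> R).
Hypothesis hf : cont_pos f.
Local Notation Finv := (primitive0 (fun y => (f y)^-1)).

(** Starting the primitive at 0 removes the case distinction at 1; the constant it introduces
    disappears after division by [t]. *)
Lemma Fint_primitive0 (y : R) : 0 <= y -> Fint f y = Finv y - Finv 1.
Proof.
have hL := halfline_continuous_L1loc (halfline_continuousV hf).
move=> y0; rewrite /Fint /primitive0; case: leP => y1.
  rewrite Rintegral_itvB ?bnd_simp //; last exact: hL.
  rewrite Rintegral_itv_obnd_cbnd //.
  by apply: integrableS (hL _ y0) => // t; rewrite /= !in_itv /= => /andP[]; lra.
have i1 := hL 1 ler01.
rewrite -opprB; congr (- _); rewrite Rintegral_itvB ?bnd_simp //; last lra.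
rewrite Rintegral_itv_obnd_cbnd //.
by apply: integrableS i1 => // t; rewrite /= !in_itv /= => /andP[]; lra.
Qed.

Lemma Finv_is_derive (y : R) : 0 < y -> is_derive y 1 Finv (f y)^-1.
Proof. by move=> y0; apply: (is_derive_primitive0 (halfline_continuousV hf)). Qed.

Lemma Finv_nondecreasing (s t : R) : 0 < s -> s <= t -> Finv s <= Finv t.
Proof.
move=> s0 st; apply: (@nondecreasing_is_derive _ Finv (fun y => (f y)^-1)) => // y sy yt.
  by apply: Finv_is_derive; lra.
by rewrite invr_ge0 ltW // hf.2 //; lra.
Qed.

Lemma Finv_lipschitz (c s t : R) : 0 < c -> (forall y, 0 <= y -> c <= f y) ->
  0 < s -> s <= t -> `|Finv t - Finv s| <= c^-1 * (t - s).
Proof.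
move=> c0 cf s0 st; rewrite ger0_norm; last by rewrite subr_ge0 Finv_nondecreasing.
have : c^-1 * s + (-1) * Finv s <= c^-1 * t + (-1) * Finv t.
  apply: (@nondecreasing_is_derive _ (fun y => c^-1 * y + (-1) * Finv y)
    (fun y => c^-1 + (-1) * (f y)^-1)) => // y sy yt.
    apply: is_derive_axpy; last by apply: Finv_is_derive; lra.
    have := is_deriveZ c^-1 (is_derive_id y (1 : R)).
    by rewrite [_ *: 1]mulr1.
  have y0 : 0 <= y by lra.
  have : (f y)^-1 <= c^-1 by rewrite lef_pV2 ?posrE ?hf.2 // cf.
  lra.
lra.
Qed.

End inverse_primitive.

(** * Limits inferior and superior at infinity, and small losses *)

Section limits.
Set Implicit Arguments.
Unset Strict Implicit.
Context {R : realType}.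
Implicit Types (u : R -> R) (l M : R).

Lemma limf_einf_ge u l :
  (forall e, 0 < e -> exists2 T, 0 < T & forall t, T <= t -> l - e <= u t) ->
  (l%:E <= limf_einf (fun t => (u t)%:E) +oo%R)%E.
Proof.
move=> H; apply/lee_addgt0Pr => e e0; rewrite limf_einfE.
have [T T0 hT] := H e e0.
rewrite -leeBlDr //; apply: le_ereal_sup_tmp.
exists (ereal_inf ((fun t => (u t)%:E) @` [set t | T < t])).
  exists [set t | T < t] => //; exists T; split => //; exact: num_real.
apply: le_ereal_inf_tmp => _ [t /= Tt <-].
by rewrite -EFinB lee_fin hT // ltW.
Qed.

Lemma limf_esup_le u l :
  (forall e, 0 < e -> exists2 T, 0 < T & forall t, T <= t -> u t <= l + e) ->
  (limf_esup (fun t => (u t)%:E) +oo%R <= l%:E)%E.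
Proof.
move=> H; apply/lee_addgt0Pr => e e0; rewrite limf_esupE.
have [T T0 hT] := H e e0.
apply: ge_ereal_inf.
exists (ereal_sup ((fun t => (u t)%:E) @` [set t | T < t])).
  exists [set t | T < t] => //; exists T; split => //; exact: num_real.
apply: ge_ereal_sup => _ [t /= Tt <-].
by rewrite -EFinD lee_fin hT // ltW.
Qed.

(** Any two neighbourhoods of [+oo] share a point [t], and [u t] separates the infimum over one from
    the supremum over the other. *)
Lemma limf_einf_le_esup (u : R -> \bar R) :
  (limf_einf u +oo%R <= limf_esup u +oo%R)%E.
Proof.
rewrite limf_einfE limf_esupE; apply: ge_ereal_sup => _ [A [M1 [_ hA]] <-].
apply: le_ereal_inf_tmp => _ [B [M2 [_ hB]] <-].
pose t := Num.max M1 M2 + 1.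
have At : A t by apply: hA; rewrite /t ltr_pwDr // le_max lexx.
have Bt : B t by apply: hB; rewrite /t ltr_pwDr // le_max lexx orbT.
apply: (@le_trans _ _ (u t)).
  by apply: ereal_inf_lbound; exists t.
by apply: ereal_sup_ubound; exists t.
Qed.

Lemma affine_ratio_ge u M b k T : 0 < M -> (forall t, T <= t -> b * t + k <= u t) ->
  forall e, 0 < e -> exists2 T', 0 < T' & forall t, T' <= t ->
    b / M - e <= u t / (M * t).
Proof.
move=> M0 hu e e0; have Me0 : 0 < M * e by rewrite mulr_gt0.
(* The middle term makes [|k| <= M e t]; the others give [t >= T] and [t > 0]. *)
exists (`|T| + `|k| / (M * e) + 1) => [|t Tt].
  by rewrite ltr_wpDl // addr_ge0 // divr_ge0 // ltW.
have k0 : 0 <= `|k| / (M * e) by rewrite divr_ge0 // ltW.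
have T0 := normr_ge0 T.
have t0 : 0 < t by lra.
rewrite ler_pdivlMr ?mulr_gt0 //.
have -> : (b / M - e) * (M * t) = b * t - M * e * t by field; rewrite gt_eqF.
have hk : `|k| <= M * e * t by rewrite mulrC -ler_pdivrMr //; lra.
have := hu t; have := ler_norm T; have := lerNnormlW (lexx `|k|).
lra.
Qed.

Lemma affine_ratio_le u M b k T : 0 < M -> (forall t, T <= t -> u t <= b * t + k) ->
  forall e, 0 < e -> exists2 T', 0 < T' & forall t, T' <= t ->
    u t / (M * t) <= b / M + e.
Proof.
move=> M0 hu e e0.
have [|T' T'0 hT'] := @affine_ratio_ge (fun t => - u t) M (- b) (- k) T M0 _ e e0.
  by move=> t /hu; lra.
by exists T' => // t /hT'; rewrite !mulNr; lra.
Qed.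

Lemma bernoulli_sub n (e : R) : 0 <= e -> e <= 1 ->
  1 - n%:R * e <= (1 - e) ^+ n.
Proof.
move=> e0 e1; elim: n => [|n IH]; first by rewrite mul0r subr0 expr0.
rewrite exprS; have h : 0 <= 1 - e by lra.
apply: le_trans (ler_wpM2l h IH); rewrite -natr1.
have -> : (1 - e) * (1 - n%:R * e) = 1 - (n%:R + 1) * e + n%:R * (e * e) by ring.
by rewrite lerDl mulr_ge0 ?ler0n // mulr_ge0.
Qed.

(** Splits an admissible total loss [q] into [n] equal factors, by Bernoulli with
    [1 - k = (1 - q) / (n + 1)]. *)
Lemma exists_root_lt1 n (q : R) : 0 < q -> q < 1 ->
  exists k, [/\ 0 < k, k < 1 & q <= k ^+ n].
Proof.
move=> q0 q1; pose e := (1 - q) / n.+1%:R.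
have n0 : 0 < (n.+1)%:R :> R by rewrite ltr0n.
have n1 : 1 <= (n.+1)%:R :> R by rewrite ler1n.
have e0 : 0 < e by rewrite divr_gt0 //; lra.
have e1 : e < 1 by rewrite ltr_pdivrMr //; lra.
have ne : n%:R * e <= 1 - q.
  have <- : n.+1%:R * e = 1 - q by rewrite /e mulrC divfK // gt_eqF.
  by rewrite ler_pM2r // ler_nat.
exists (1 - e); split; [lra|lra|].
by apply: le_trans (bernoulli_sub n _ _); lra.
Qed.

End limits.

(** * Finite mass and bounds on convolutions with [mu] *)

Section mass.
Set Implicit Arguments.
Unset Strict Implicit.
Context {R : realType} (mu : {measure set (measurableTypeR R) -> \bar R}).
Hypothesis mu_fin : (mu (halfline R) < +oo)%E.
Hypothesis mu_gt0 : (0 < mu (halfline R))%E.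
Implicit Types (g : R -> R) (t : R).

Lemma measurable_halfline : measurable (halfline R : set (measurableTypeR R)).
Proof. exact: measurable_itv. Qed.

Lemma total_massE : mu (halfline R) = (total_mass mu)%:E.
Proof. by rewrite /total_mass fineK // ge0_fin_numE. Qed.

Lemma total_mass_gt0 : 0 < total_mass mu.
Proof. by rewrite -lte_fin -total_massE. Qed.

Lemma segment_mass_le t : (mu `[0%R, t]%classic <= mu (halfline R))%E.
Proof.
apply: le_measure; rewrite ?inE; [exact: measurable_itv|exact: measurable_halfline|].
by move=> s; rewrite /halfline /= !in_itv /= andbT => /andP[].
Qed.

Lemma segment_mass_lty t : (mu `[0%R, t]%classic < +oo)%E.
Proof. exact: le_lt_trans (segment_mass_le t) mu_fin. Qed.

Lemma segment_massE t : mu `[0, t]%classic = (fine (mu `[0, t]%classic))%:E.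
Proof. by rewrite fineK // ge0_fin_numE // segment_mass_lty. Qed.

(** Continuity from below along the segments [[0, n]]. *)
Lemma segment_mass_ge k : 0 < k -> k < 1 ->
  exists2 T, 0 < T & k * total_mass mu <= fine (mu `[0, T]%classic).
Proof.
move=> k0 k1; have M0 := total_mass_gt0.
pose A n : set (measurableTypeR R) := `[0, n%:R]%classic.
have UA : \bigcup_n A n = halfline R.
  apply/seteqP; split => t /=.
    by move=> [n _]; rewrite /A /halfline /= !in_itv /= andbT => /andP[].
  rewrite /halfline /= in_itv /= andbT => t0.
  have [n tn] : exists n, t < n%:R by exists (Num.bound t); exact: archi_boundP.
  by exists n => //; rewrite /A /= in_itv /= t0 ltW.
have mA n : measurable (A n) by exact: measurable_itv.
have ndA : {homo A : n m / (n <= m)%N >-> (n <= m)%O}.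
  move=> n m nm; apply/subsetPset => t; rewrite /A /= !in_itv /= => /andP[-> tn] /=.
  by apply: le_trans tn _; rewrite ler_nat.
have := @nondecreasing_cvg_mu _ _ _ mu A mA.
rewrite UA => /(_ measurable_halfline ndA); rewrite total_massE.
move/fine_cvgP => [_ /cvgrPdist_le].
have e0 : 0 < (1 - k) * total_mass mu by rewrite mulr_gt0 //; lra.
move=> /(_ _ e0) [N _ hN].
(* The successor makes the delay strictly positive. *)
have := hN N.+1 (leqnSn N); rewrite /= ler_distlC => /andP[h _].
exists N.+1%:R; first by rewrite ltr0n.
by move: h; rewrite /A; lra.
Qed.

Lemma convolution_integrable g t : 0 <= t -> {within halfline R, continuous g} ->
  mu.-integrable `[0, t] (EFin \o (fun s => g (t - s))).
Proof.
move=> t0 cg.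
have cgt : {within `[0, t], continuous (fun s => g (t - s))}.
  apply/subspace_continuousP => s; rewrite /= in_itv /= => /andP[s0 st].
  apply/cvgrPdist_lt => e e0; have ts0 : 0 <= t - s by lra.
  have [d d0 hd] := iffLR (halfline_continuousP g) cg _ ts0 e e0.
  exists d => //= y sy; rewrite in_itv /= => /andP[y0 yt].
  rewrite distrC; apply: hd; first lra.
  by move: sy; rewrite (_ : t - y - (t - s) = s - y) //; ring.
apply: measurable_bounded_integrable.
- exact: measurable_itv.
- exact: segment_mass_lty.
- by apply: measurable_realfun.subspace_continuous_measurable_fun => //; exact: measurable_itv.
- have [c _ hc] := EVT_max t0 cgt; have [c' _ hc'] := EVT_min t0 cgt.
  exists (`|g (t - c)| + `|g (t - c')|); split; first exact: num_real.
  move=> M hM s /= sI; have := hc s sI; have := hc' s sI.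
  have := ler_norm (g (t - c)); have := lerNnormlW (lexx `|g (t - c')|).
  have := normr_ge0 (g (t - c)); have := normr_ge0 (g (t - c')).
  by move=> *; rewrite ler_norml; apply/andP; split; lra.
Qed.

Lemma convolution_le g t C : 0 <= t -> {within halfline R, continuous g} -> 0 <= C ->
  (forall s, 0 <= s -> s <= t -> g s <= C) ->
  \int[mu]_(s in `[0, t]) g (t - s) <= C * total_mass mu.
Proof.
move=> t0 cg C0 gC.
have mI : measurable (`[0, t]%classic : set (measurableTypeR R)) by exact: measurable_itv.
apply: (@le_trans _ _ (\int[mu]_(s in `[0, t]) C)).
  apply: le_Rintegral => //; first exact: convolution_integrable.
    have cC : {within halfline R, continuous (fun=> C)}.
      by apply: continuous_subspaceT => ?; exact: cvg_cst.
    exact: (convolution_integrable t0 cC).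
  by move=> s; rewrite /= in_itv /= => /andP[s0 st]; apply: gC; lra.
rewrite Rintegral_cst // ler_wpM2l // -lee_fin -segment_massE -total_massE.
exact: segment_mass_le.
Qed.

(** Only delays up to [T] are kept; the others contribute a nonnegative amount. *)
Lemma convolution_ge g t T c : 0 <= T -> T <= t -> {within halfline R, continuous g} ->
  0 <= c -> (forall s, 0 <= s -> s <= t -> 0 <= g s) ->
  (forall s, t - T <= s -> s <= t -> c <= g s) ->
  c * fine (mu `[0, T]%classic) <= \int[mu]_(s in `[0, t]) g (t - s).
Proof.
move=> T0 Tt cg c0 g0 gc; have t0 : 0 <= t by lra.
have mI a b : measurable (`[a, b]%classic : set (measurableTypeR R)).
  exact: measurable_itv.
have mJ : measurable (`]T, t]%classic : set (measurableTypeR R)).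
  exact: measurable_itv.
have E : `[0, t]%classic = `[0, T]%classic `|` `]T, t]%classic :> set (measurableTypeR R).
  by rewrite -itv_bndbnd_setU // bnd_simp.
have ig := convolution_integrable t0 cg.
have igT : mu.-integrable `[0, T] (EFin \o (fun s => g (t - s))).
  by apply: integrableS ig => // s; rewrite E; left.
rewrite E Rintegral_setU //; last 2 first.
- by rewrite -E.
- apply/disj_setPS => s [] /=; rewrite !in_itv /= => /andP[_ h1] /andP[h2 _]; lra.
rewrite -[leLHS]addr0; apply: lerD; last first.
  by apply: Rintegral_ge0 => s; rewrite /= in_itv /= => /andP[? ?]; apply: g0; lra.
rewrite -Rintegral_cst //; apply: le_Rintegral => //.
  have cC : {within halfline R, continuous (fun=> c)}.
    by apply: continuous_subspaceT => ?; exact: cvg_cst.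
  exact: (convolution_integrable T0 cC).
by move=> s; rewrite /= in_itv /= => /andP[? ?]; apply: gc; lra.
Qed.

End mass.

(** * Differential inequalities with a delay *)

Section delayed_growth.
Set Implicit Arguments.
Unset Strict Implicit.
Context {R : realType}.
Implicit Types (a b k s t : R) (u v : R -> R).

Lemma ac_deriv_le_increment a b u v u' v' : a <= b ->
  ac_deriv a b u v -> ac_deriv a b u' v' ->
  (forall t, a < t -> t < b -> v' t <= v t) -> u' b - u' a <= u b - u a.
Proof.
move=> ab hu hu' vv'.
suff : u a + (-1) * u' a <= u b + (-1) * u' b by lra.
apply: ac_deriv_le ab (ac_deriv_axpy (-1) hu hu') _ => t at' tb.
by have := vv' t at' tb; lra.
Qed.

(* At a first time [t] where the line [b t + k] is reached, [u] has gained at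
   most about [b T1] during the delay, so the hypothesis makes [u] grow at
   least as fast as the line just before [t]. *)
Lemma delayed_growth T T1 b u v : 0 <= T -> 0 <= T1 -> 0 <= b ->
  (forall t, T + T1 <= t -> ac_deriv (T + T1) t u v) ->
  (forall s t, T <= s -> s <= t -> u s <= u t) ->
  (forall t, T + T1 < t -> u t - u (t - T1) <= b * T1 + 1 -> b <= v t) ->
  forall t, T + T1 <= t -> b * t + (u T - b * (T + T1) - 1) <= u t.
Proof.
(* With this [k] the line is at most [u T - 1] up to [T + T1], hence strictly below [u] on
   [[T, T + T1]]. *)
move=> T0 T10 b0 acu ndu growth; set k := u T - b * (T + T1) - 1.
have init s : T <= s -> s <= T + T1 -> b * s + k < u s.
  move=> Ts sT; have := ndu _ _ (lexx T) Ts.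
  have : b * s <= b * (T + T1) by exact: ler_wpM2l.
  rewrite /k; lra.
move=> t1 Tt1; rewrite leNgt; apply/negP => ut1.
(* Times up to which [u] stays strictly above the line. Were [u] still above it at [sup S],
   continuity would extend [S]; so the line is reached there. *)
pose S := [set t | [/\ T + T1 <= t, t <= t1 &
  forall s, T <= s -> s <= t -> b * s + k < u s]].
have ST : S (T + T1) by split.
have hS : has_sup S by split; [exists (T + T1)|exists t1 => t []].
have TS : T + T1 <= sup S by exact: (sup_upper_bound hS).
have St1 : sup S <= t1 by apply: ge_sup; [exists (T + T1)|move=> t []].
have below s : T <= s -> s < sup S -> b * s + k < u s.
  move=> Ts sS; have d0 : 0 < sup S - s by rewrite subr_gt0.
  have [t [_ _ ht]] := sup_adherent d0 hS.
  by rewrite opprB addrCA subrr addr0 => st; apply: ht => //; exact: ltW.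
have acq : ac_deriv (T + T1) t1 (fun t => u t + (- b) * t) (fun t => v t + (- b) * 1).
  by apply: ac_deriv_axpy; [exact: acu|exact: ac_deriv_id].
have cq := abs_cont_on_continuous acq.1 TS St1.
have [qS|qS] := ltP (b * sup S + k) (u (sup S)).
  have [|d d0 hd] := cq (u (sup S) - (b * sup S + k)); first lra.
  have [St1'|] := ltP (sup S) t1; last first.
    move=> h; have E : sup S = t1 by lra.
    by rewrite E in qS; lra.
  pose w := Num.min t1 (sup S + d / 2).
  have Sw : sup S < w by rewrite lt_min St1' /=; lra.
  have wt1 : w <= t1 by rewrite ge_min lexx.
  have wS : w <= sup S + d / 2 by rewrite ge_min lexx orbT.
  have : S w.
    split => //; first lra.
    move=> s Ts sw; have [sS|Ss] := ltP s (sup S); first exact: below.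
    have /hd : T + T1 <= s by lra.
    have -> : `|s - sup S| < d by rewrite ger0_norm; lra.
    have -> : s <= t1 by lra.
    move=> /(_ isT isT); rewrite ltr_norml => /andP[h _]; lra.
  by move/(sup_upper_bound hS); lra.
(* Near [sup S], [u t - b t] exceeds its value there, at most [k], by less than 1, while [u] is
   above the line at [t - T1]: this is the [+ 1] in the growth hypothesis. Then [u t - b t] is
   nondecreasing up to [sup S], though it started above [k]. *)
have [d d0 hd] := cq 1 ltr01.
have [s0 [Ts0 s0t hs0] ds0] := sup_adherent d0 hS.
have s0S : s0 <= sup S by exact: (sup_upper_bound hS).
have : u s0 + (- b) * s0 <= u (sup S) + (- b) * sup S.
  apply: ac_deriv_le s0S (ac_deriv_sub Ts0 St1 acq) _ => t s0t' tS.
  suff : b <= v t by lra.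
  apply: growth; first lra.
  have h1 : b * (t - T1) + k < u (t - T1) by apply: below; lra.
  have /hd : T + T1 <= t by lra.
  have -> : `|t - sup S| < d by rewrite ler0_norm; lra.
  have -> : t <= t1 by lra.
  move=> /(_ isT isT); rewrite ltr_norml => /andP[_ h]; lra.
have : b * s0 + k < u s0 by apply: hs0; lra.
lra.
Qed.

End delayed_growth.

(** * The equation and the unforced part [z] of a solution *)

Section equation.
Set Implicit Arguments.
Unset Strict Implicit.
Context {R : realType} (mu : {measure set (measurableTypeR R) -> \bar R}).
Context (f h phi dphi x : R -> R) (psi L : R).
Hypothesis mu_gt0 : (0 < mu (halfline R))%E.
Hypothesis mu_fin : (mu (halfline R) < +oo)%E.
Hypothesis hf : cont_pos f.
Hypothesis hh : L1loc h.
Hypothesis hH : forall t : R, 0 <= t -> 0 <= primitive0 h t.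
Hypothesis hpsi : 0 < psi.
Hypothesis hphi : asymp_class f phi dphi.
Hypothesis hx : is_solution mu f h psi x.
Implicit Types (a b k l s t y : R).

Local Notation M := (total_mass mu).
Local Notation H := (primitive0 h).
Local Notation J := (primitive0 (fun s => f (H s))).
Local Notation Finv := (primitive0 (fun y => (f y)^-1)).
Local Notation z t := (x t + (-1) * H t).
Local Notation G t := (\int[mu]_(s in `[0, t]) f (x (t - s))).

Let M_gt0 : 0 < M. Proof. exact: total_mass_gt0. Qed.
Let f_gt0 y : 0 <= y -> 0 < f y. Proof. exact: hf.2. Qed.
Let x_ge0 t : 0 <= t -> 0 <= x t. Proof. by case: hx => _ + _ _; apply. Qed.

Let phi_gt0 y : 0 <= y -> 0 < phi y. Proof. by case: hphi => -[_]; auto. Qed.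

Let f_lb : exists2 c, 0 < c & forall y, 0 <= y -> c <= f y.
Proof. exact: asymp_class_lower_bound hphi. Qed.

(** Subtracting [H] cancels [h], whose sign is arbitrary, and leaves a nonnegative derivative. *)
Lemma z_ac_deriv a b : 0 <= a -> a <= b -> ac_deriv a b (fun t => z t) (fun t => G t).
Proof.
move=> a0 ab; have b0 : 0 <= b by lra.
apply: (@ac_deriv_sub _ 0 b) => //; case: hx => acx _ dx _.
have dx' : ac_deriv 0 b x (fun t => G t + h t).
  by split; [exact: acx|apply: ae_leb_imp dx => t dx t0 _; exact: dx].
have [acz dz] := ac_deriv_axpy (-1) dx' (ac_deriv_primitive0 hh b0).
split => //; apply: ae_leb_imp dz => t dz at' tb.
by have := dz at' tb; rewrite mulN1r addrK.
Qed.

Lemma G_ge0 t : 0 <= t -> 0 <= G t.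
Proof.
move=> t0; apply: Rintegral_ge0 => s; rewrite /= in_itv /= => /andP[s0 st].
by apply/ltW/f_gt0/x_ge0; lra.
Qed.

Lemma z_nondecreasing s t : 0 <= s -> s <= t -> z s <= z t.
Proof.
move=> s0 st; apply: (ac_deriv_le st (z_ac_deriv s0 st)) => y sy _.
by apply: G_ge0; lra.
Qed.

Lemma z_ge_psi t : 0 <= t -> psi <= z t.
Proof.
move=> t0; apply: le_trans (z_nondecreasing (lexx 0) t0).
by case: hx => _ _ _ ->; rewrite primitive0_0 mulr0 addr0.
Qed.

Lemma z_le_x t : 0 <= t -> z t <= x t.
Proof. by move=> t0; have := hH t0; lra. Qed.

Lemma H_le_x t : 0 <= t -> H t <= x t.
Proof. by move=> t0; have := z_ge_psi t0; have := hpsi; lra. Qed.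

Lemma fx_continuous : {within halfline R, continuous (fun t => f (x t))}.
Proof.
apply: halfline_continuous_comp => //; first exact: hf.1.
by apply: loc_abs_cont_continuous; case: hx.
Qed.

Lemma H_continuous : {within halfline R, continuous H}.
Proof.
by apply: loc_abs_cont_continuous => b b0; exact: abs_cont_on_primitive0.
Qed.

Lemma fH_continuous : {within halfline R, continuous (fun t => f (H t))}.
Proof. by apply: halfline_continuous_comp => //; [exact: hf.1|exact: H_continuous]. Qed.

Lemma J_ac_deriv a b : 0 <= a -> a <= b -> ac_deriv a b J (fun t => f (H t)).
Proof.
move=> a0 ab; apply: (@ac_deriv_sub _ 0 b) => //.
by apply: ac_deriv_primitive0; [exact: halfline_continuous_L1loc fH_continuous|lra].
Qed.

(** As [f o H] is continuous, [J] is differentiable at every positive point, so no null set needs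
    translating. *)
Lemma J_shift_ac_deriv a b c : 0 <= a - c -> a <= b ->
  ac_deriv a b (fun t => J (t - c)) (fun t => f (H (t - c))).
Proof.
move=> ac ab; split.
  by apply: abs_cont_on_shift; case: (@J_ac_deriv (a - c) (b - c)) => //; lra.
apply: aeW => t at' _.
have tc : 0 < t - c by lra.
have := @is_derive1_comp _ J (center c) t _ _
  (is_derive_primitive0 fH_continuous tc) (is_derive_shift t 1 (- c)).
by rewrite mulr1.
Qed.

Lemma J_nondecreasing s t : 0 <= s -> s <= t -> J s <= J t.
Proof.
move=> s0 st; apply: (ac_deriv_le st (J_ac_deriv s0 st)) => y sy _.
by apply/ltW/f_gt0/hH; lra.
Qed.

Lemma J_ge_linear c t : (forall y, 0 <= y -> c <= f y) -> 0 <= t -> c * t <= J t.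
Proof.
move=> cf t0.
suff : c * t - c * 0 <= J t - J 0 by rewrite primitive0_0; lra.
apply: (ac_deriv_le_increment t0 (J_ac_deriv (lexx 0) t0) (ac_deriv_linear 0 t c)).
by move=> s s0 _; apply/cf/hH/ltW.
Qed.

Lemma J_large K : exists2 T, 0 < T & forall t, T <= t -> K <= J t.
Proof.
have [c c0 cf] := f_lb; exists (`|K| / c + 1) => [|t Tt].
  by rewrite ltr_wpDl // divr_ge0 // ltW.
have Kc : 0 <= `|K| / c by rewrite divr_ge0 // ltW.
have t0 : 0 <= t by lra.
apply: le_trans (J_ge_linear cf t0).
have : `|K| / c <= t by lra.
by rewrite ler_pdivrMr // mulrC; apply: le_trans; exact: ler_norm.
Qed.

Lemma G_ge t T c : 0 <= T -> T <= t -> 0 <= c ->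
  (forall s, t - T <= s -> s <= t -> c <= f (x s)) ->
  c * fine (mu `[0, T]%classic) <= G t.
Proof.
move=> T0 Tt c0 cf; apply: (@convolution_ge _ mu mu_fin (fun s => f (x s))) => //.
  exact: fx_continuous.
by move=> s s0 _; apply/ltW/f_gt0/x_ge0.
Qed.

Lemma G_le t C : 0 <= t -> 0 <= C ->
  (forall s, 0 <= s -> s <= t -> f (x s) <= C) -> G t <= C * M.
Proof.
move=> t0 C0 fC; apply: (@convolution_le _ mu mu_fin (fun s => f (x s))) => //.
exact: fx_continuous.
Qed.

(** Once half of the mass lies in [[0, T1]], the lower bound [c] of [f] gives [z' >= c m] beyond
    [T1]. *)
Lemma z_large K : exists2 T, 0 < T & forall t, T <= t -> K <= z t.
Proof.
have [c c0 cf] := f_lb.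
have [| |T1 T10 hT1] := @segment_mass_ge _ _ mu_fin mu_gt0 (1 / 2); try lra.
set m := fine _ in hT1; have m0 : 0 < m by have := M_gt0; lra.
have cm0 : 0 < c * m by rewrite mulr_gt0.
exists (T1 + `|K| / (c * m)) => [|t Tt]; first by rewrite ltr_wpDr // divr_ge0 // ltW.
have K0 : 0 <= `|K| / (c * m) by rewrite divr_ge0 // ltW.
have T1t : T1 <= t by lra.
have zT : (c * m) * t - (c * m) * T1 <= z t - z T1.
  apply: (ac_deriv_le_increment T1t (z_ac_deriv (ltW T10) T1t) (ac_deriv_linear T1 t (c * m))).
  move=> s T1s _; apply: G_ge => //; try lra.
  by move=> y sy _; apply/cf/x_ge0; lra.
have : `|K| / (c * m) <= t - T1 by lra.
rewrite ler_pdivrMr //; have := ler_norm K; have := z_ge_psi (ltW T10).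
by have := hpsi; lra.
Qed.

(** * Linear lower bound for [Finv (x t)] *)

Lemma Finv_z_ac_deriv a b : 0 <= a -> a <= b ->
  ac_deriv a b (fun t => Finv (z t)) (fun t => (f (z t))^-1 * G t).
Proof.
move=> a0 ab; have [c c0 cf] := f_lb.
apply: (@ac_deriv_comp _ a b psi c^-1 Finv (fun y => (f y)^-1) (fun t => z t)).
- by move=> y y' py yy'; apply: Finv_lipschitz => //; have := hpsi; lra.
- by move=> y py; apply: Finv_is_derive => //; have := hpsi; lra.
- by move=> t at' _; apply: z_ge_psi; lra.
- exact: z_ac_deriv.
Qed.

(* The mean value theorem for [phi] against [Finv]: [phi' <= eta] and
   [1 / f >= k / phi y] on [[w, y]]. *)
Lemma phi_increment X k eta w y : 0 < X -> 0 < k -> 0 <= eta ->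
  (forall s, X <= s -> k * f s <= phi s) -> (forall s, X <= s -> dphi s <= eta) ->
  X <= w -> w <= y ->
  phi y - phi w <= eta / k * phi y * (Finv y - Finv w).
Proof.
move=> X0 k0 eta0 fphi dp Xw wy; set A := eta / k * phi y.
suff : A * Finv w + (-1) * phi w <= A * Finv y + (-1) * phi y by lra.
apply: (@nondecreasing_is_derive _ (fun s => A * Finv s + (-1) * phi s)
  (fun s => A * (f s)^-1 + (-1) * dphi s) w y wy) => s ws sy.
  apply: is_derive_axpy; last by apply: (asymp_class_is_derive hphi); lra.
  by apply: (is_deriveZ A); apply: Finv_is_derive => //; lra.
suff : eta <= A * (f s)^-1 by have := dp s; lra.
have fs : 0 < f s by apply: f_gt0; lra.
rewrite ler_pdivlMr // /A mulrAC ler_pdivlMr // -mulrA ler_wpM2l // mulrC.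
apply: le_trans (fphi s _) _; first lra.
by apply: (asymp_class_nondecreasing hphi); lra.
Qed.

Lemma Finv_x_ge_affine b : 0 < b -> b < M ->
  exists T k, forall t, T <= t -> b * t + k <= Finv (x t).
Proof.
move=> b0 bM.
(* Four losses: the mass beyond the delay, [f] against [phi] at [x s], [phi] across the delay, and
   [phi] against [f] at [z t]. *)
have [| |k [k0 k1 kb]] := @exists_root_lt1 R 4 (b / M).
- by rewrite divr_gt0.
- by rewrite ltr_pdivrMr // mul1r.
have {}kb : b <= k ^+ 4 * M by rewrite -ler_pdivrMr.
have [T1 T10 hT1] := segment_mass_ge mu_fin mu_gt0 k0 k1.
(* If [Finv o z] grows by at most [b T1 + 1] over the delay, [phi_increment] with this [eta] bounds
   the change of [phi] by [(1 - k) phi (z t)]. *)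
pose eta := k * (1 - k) / (b * T1 + 1).
have bT1 : 0 < b * T1 + 1 by rewrite ltr_pwDr // mulr_ge0 // ltW.
have eta0 : 0 < eta by rewrite divr_gt0 // mulr_gt0 //; lra.
have [X1 X10 hX1] := asymp_class_deriv_small hphi eta0.
have [X2 X20 hX2] := asymp_class_equiv hphi k0 k1.
have [T T0 hT] := z_large (X1 + X2).
(* The growth hypothesis of [delayed_growth] for [Finv o z]; below, [w = z (t - T1)] and
   [y = z t]. *)
have key t : T + T1 < t -> Finv (z t) - Finv (z (t - T1)) <= b * T1 + 1 ->
    b <= (f (z t))^-1 * G t.
  move=> Tt; have Tt' : T <= t - T1 by lra.
  have t0 : 0 <= t - T1 by lra.
  have tt : t - T1 <= t by lra.
  have T1t : T1 <= t by lra.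
  have Xw := hT _ Tt'; have wy := z_nondecreasing t0 tt.
  have GT : k * phi (z (t - T1)) * fine (mu `[0, T1]%classic) <= G t.
    apply: G_ge (ltW T10) T1t _ _ => [|s ts st].
      by rewrite mulr_ge0 ?ltW // phi_gt0 //; apply: le_trans Xw; lra.
    have ws := z_nondecreasing t0 ts; have zx := z_le_x (le_trans t0 ts).
    have wx := le_trans ws zx; have Xx := le_trans Xw wx.
    have [h1 _] := hX2 (x s) (le_trans (ltW (ltr_pwDl X10 (lexx X2))) Xx).
    apply: le_trans h1; rewrite ler_pM2l //.
    apply: (asymp_class_nondecreasing hphi) wx.
    by apply: lt_le_trans Xw; lra.
  move: (z (t - T1)) (z t) (G t) Xw wy GT => w y g Xw wy GT.
  clear t tt t0 Tt Tt' T1t.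
  have fy : 0 < f y by apply: f_gt0; lra.
  have pw : 0 < phi w by apply: phi_gt0; lra.
  have py : 0 < phi y by apply: phi_gt0; lra.
  have inc : phi y - phi w <= eta / k * phi y * (Finv y - Finv w).
    apply: (@phi_increment (X1 + X2)) => //; [lra|exact: ltW| |].
      by move=> s Xs; have [] := hX2 s _; lra.
    by move=> s Xs; apply: hX1; lra.
  move: (Finv y - Finv w) inc => d inc hd.
  have inc' : eta / k * phi y * d <= (1 - k) * phi y.
    have -> : (1 - k) * phi y = eta / k * phi y * (b * T1 + 1).
      by rewrite /eta; field; rewrite !gt_eqF.
    by rewrite ler_wpM2l // ltW // mulr_gt0 // divr_gt0.
  have pwy : k * phi y <= phi w by lra.
  rewrite mulrC ler_pdivlMr //; apply: le_trans GT.
  have [|_ fphi] := hX2 y; first lra.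
  apply: (@le_trans _ _ (k ^+ 4 * M * f y)); first by rewrite ler_pM2r.
  have -> : k ^+ 4 * M * f y = k * k * M * (k * (k * f y)) by ring.
  have kM : 0 < k * M by rewrite mulr_gt0.
  apply: (@le_trans _ _ (k * phi w * (k * M))); last by rewrite ler_wpM2l // mulr_ge0 // ltW.
  have -> : k * phi w * (k * M) = k * k * M * phi w by ring.
  rewrite ler_wpM2l //; first by rewrite !mulr_ge0 // ltW.
  by apply: le_trans pwy; rewrite ler_pM2l.
have TT0 : 0 <= T + T1 by lra.
have acz s : T + T1 <= s ->
    ac_deriv (T + T1) s (fun t => Finv (z t)) (fun t => (f (z t))^-1 * G t).
  exact: Finv_z_ac_deriv.
have ndz s s' : T <= s -> s <= s' -> Finv (z s) <= Finv (z s').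
  move=> Ts ss'; have s0 : 0 <= s by lra.
  apply: Finv_nondecreasing (z_nondecreasing s0 ss') => //.
  exact: lt_le_trans (z_ge_psi s0).
have main := delayed_growth (ltW T0) (ltW T10) (ltW b0) acz ndz key.
exists (T + T1); exists (Finv (z T) - b * (T + T1) - 1) => t Tt.
have t0 := le_trans TT0 Tt.
apply: le_trans (main t Tt) _.
by apply: Finv_nondecreasing (z_le_x t0) => //; exact: lt_le_trans (z_ge_psi t0).
Qed.

(** * Comparison of [H] with [J]; the upper bound and the bound on [x / H] *)

Hypothesis hL : H t / (M * J t) @[t --> +oo] --> L.
Hypothesis L_gt0 : 0 < L.

Lemma J_gt0 t : 0 < t -> 0 < J t.
Proof.
move=> t0; have [c c0 cf] := f_lb.
by apply: lt_le_trans (J_ge_linear cf (ltW t0)); rewrite mulr_gt0.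
Qed.

Lemma H_ratio e : 0 < e -> exists2 T, 0 < T & forall t, T <= t ->
  (L - e) * (M * J t) <= H t /\ H t <= (L + e) * (M * J t).
Proof.
move=> e0; have /cvgrPdist_le /(_ e e0) /near_pinfty_ex [T T0 hT] := hL.
exists T => // t Tt; have MJ : 0 < M * J t.
  by rewrite mulr_gt0 // J_gt0 //; exact: lt_le_trans Tt.
by have := hT t Tt; rewrite ler_distlC ler_pdivlMr // ler_pdivrMr // => /andP[].
Qed.

(** [C] absorbs a compact initial interval: the bound must hold at all times, since [G t] sees the
    whole history of [x]. *)
Lemma H_le_J l : L < l ->
  exists2 C, 0 < C & forall t, 0 <= t -> H t <= l * M * J t + C.
Proof.
move=> Ll; have [|T T0 hT] := @H_ratio (l - L); first by rewrite subr_gt0.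
have [C C0 hC] := continuous_bounded H_continuous (ltW T0).
exists C => // t t0; have [tT|Tt] := leP t T.
  apply: le_trans (hC t t0 tT) _; rewrite lerDr; apply: mulr_ge0.
    by rewrite mulr_ge0 ?ltW // (lt_trans L_gt0).
  by have := J_nondecreasing (lexx 0) t0; rewrite primitive0_0.
have [_] := hT t (ltW Tt); rewrite addrC subrK mulrA => h1.
by apply: le_trans h1 _; rewrite lerDl ltW.
Qed.

(** [f] need not be monotone, so its values up to [y'] are controlled through the increasing [phi];
    [C] covers the range where [f] and [phi] are not yet comparable. *)
Lemma f_le_phi k : 0 < k -> k < 1 -> exists2 C, 0 < C &
  forall y y', 0 <= y -> y <= y' -> 0 < y' -> f y <= C + k^-1 * phi y'.
Proof.
move=> k0 k1; have [X X0 hX] := asymp_class_equiv hphi k0 k1.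
have [C C0 hC] := continuous_bounded hf.1 (ltW X0).
exists C => // y y' y0 yy' y'0.
have py' : 0 < k^-1 * phi y' by rewrite mulr_gt0 ?invr_gt0 // phi_gt0 // ltW.
have [yX|Xy] := leP y X; first by have := hC y y0 yX; lra.
have [_ kf] := hX y (ltW Xy).
have yg0 := lt_trans X0 Xy.
have : f y <= k^-1 * phi y'.
  rewrite mulrC ler_pdivlMr // mulrC; apply: le_trans kf _.
  exact: (asymp_class_nondecreasing hphi) yy'.
by lra.
Qed.

(* The bracket [C + phi y / k] bounds [f (x s)], [s <= t], and [f (H t)] once
   [x s] and [H t] are at most [y]; it is about [f y] for large [y]. *)
Lemma bracket_le k C : 0 < k -> k < 1 -> exists2 X, 0 < X & forall y, X <= y ->
  k ^+ 3 * (C + k^-1 * phi y) <= f y.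
Proof.
move=> k0 k1; have [X1 X10 h1] := asymp_class_equiv hphi k0 k1.
(* Beyond [X2], [|C| <= (1 - k) phi y], so [k^2 (C + phi y / k) <= phi y]; the last factor [k] pays
   for [k phi <= f]. *)
have [X2 X20 h2] := asymp_class_large hphi (`|C| / (1 - k)).
exists (X1 + X2) => [|y Xy]; first by rewrite addr_gt0.
have [|kp _] := h1 y; first lra.
have Xy2 : X2 <= y by lra.
have /h2 : X2 <= y by lra.
have k1' : 0 < 1 - k by lra.
rewrite ler_pdivrMr // => hC.
apply: le_trans kp; rewrite exprS -mulrA ler_pM2l //.
have -> : k ^+ 2 * (C + k^-1 * phi y) = k * (k * C) + k * phi y.
  by rewrite mulrDr expr2 -!mulrA mulVKf // gt_eqF.
have kC : k * (k * C) <= `|C|.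
  apply: le_trans (ler_norm _) _; rewrite !normrM !(gtr0_norm k0).
  have := normr_ge0 C; set c := `|C| => c0.
  apply: (@le_trans _ _ (1 * c)); last by rewrite mul1r.
  rewrite mulrA ler_wpM2r //; nra.
lra.
Qed.

Lemma Finv_x_le_affine e : 0 < e ->
  exists T k, forall t, T <= t -> Finv (x t) <= (1 + L + e) * M * t + k.
Proof.
(* Half of [e] separates [l] from [L]; the other half pays for the factor [k^3] of [bracket_le]. *)
move=> e0; pose l := L + e / 2.
have Ll : L < l by rewrite /l; lra.
have l0 : 0 < l := lt_trans L_gt0 Ll.
have lM0 : 0 < l * M by rewrite mulr_gt0.
have d0 : 0 < 1 + L + e by rewrite !addr_gt0.
have [| |k [k0 k1 kq]] := @exists_root_lt1 R 3 ((1 + l) / (1 + L + e)).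
- by rewrite divr_gt0 // addr_gt0.
- by rewrite ltr_pdivrMr // mul1r /l; lra.
have {}kq : 1 + l <= k ^+ 3 * (1 + L + e) by rewrite -ler_pdivrMr.
have [C C0 hC] := H_le_J Ll.
(* A nondecreasing majorant of [x], which need not be monotone itself. *)
pose xb t := z t + l * M * J t + 1 * cst C t.
have xbac a b : 0 <= a -> a <= b ->
    ac_deriv a b xb (fun t => G t + l * M * f (H t) + 1 * cst 0 t).
  move=> a0 ab; have acz := z_ac_deriv a0 ab; have acJ := J_ac_deriv a0 ab.
  exact: ac_deriv_axpy (ac_deriv_axpy (l * M) acz acJ) (ac_deriv_cst a b C).
have J_ge0 t : 0 <= t -> 0 <= J t.
  by move=> t0; have := J_nondecreasing (lexx 0) t0; rewrite primitive0_0.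
have z_le_xb t : 0 <= t -> z t <= xb t.
  move=> t0; rewrite /xb mul1r -addrA lerDl addr_ge0 ?(ltW C0) //.
  by rewrite mulr_ge0 ?(ltW lM0) // J_ge0.
have x_le_xb t : 0 <= t -> x t <= xb t.
  move=> t0; rewrite /xb mul1r mulN1r -addrA -addrA lerDl.
  by rewrite addrC subr_ge0 hC.
have xb_nd s t : 0 <= s -> s <= t -> xb s <= xb t.
  move=> s0 st; apply: ac_deriv_le st (xbac _ _ s0 st) _ => y sy _.
  have y0 : 0 <= y by exact: le_trans s0 (ltW sy).
  rewrite mulr0 addr0 addr_ge0 ?G_ge0 // mulr_ge0 ?(ltW lM0) //.
  by apply/ltW/f_gt0/hH.
have xb_psi t : 0 <= t -> psi <= xb t.
  by move=> t0; exact: le_trans (z_ge_psi t0) (z_le_xb t t0).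
have [C' C'0 hC'] := f_le_phi k0 k1.
have [X X0 hX] := bracket_le C' k0 k1.
have [T T0 hT] := z_large X.
have Fac a b : 0 <= a -> a <= b -> ac_deriv a b (fun t => Finv (xb t))
    (fun t => (f (xb t))^-1 * (G t + l * M * f (H t) + 1 * cst 0 t)).
  move=> a0 ab; have [c c0 cf] := f_lb.
  apply: (@ac_deriv_comp _ a b psi c^-1 Finv (fun y => (f y)^-1) xb).
  - by move=> y y' py yy'; apply: (Finv_lipschitz hf c0 cf) yy'; exact: lt_le_trans py.
  - by move=> y py; apply: Finv_is_derive => //; exact: lt_le_trans py.
  - by move=> t at' _; apply: xb_psi; exact: le_trans at'.
  - exact: xbac.
have key t : T < t ->
    (f (xb t))^-1 * (G t + l * M * f (H t) + 1 * cst 0 t) <= (1 + L + e) * M.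
  move=> Tt; have t0 : 0 <= t by exact: le_trans (ltW T0) (ltW Tt).
  have xbt : 0 < xb t by exact: lt_le_trans (xb_psi t t0).
  (* [S] bounds both [f (x s)] for [s <= t] and [f (H t)], so the derivative of [xb] is at most
     [(1 + l) M S]. *)
  pose S := C' + k^-1 * phi (xb t).
  have S0 : 0 <= S.
    by rewrite addr_ge0 ?(ltW C'0) // mulr_ge0 ?invr_ge0 ?ltW // phi_gt0 // ltW.
  have GS : G t <= S * M.
    apply: G_le => // s s0 st; apply: hC' (x_ge0 s0) _ xbt.
    exact: le_trans (x_le_xb s s0) (xb_nd s t s0 st).
  have HS : f (H t) <= S.
    apply: hC' (hH t0) _ xbt; exact: le_trans (H_le_x t0) (x_le_xb t t0).
  have : k ^+ 3 * S <= f (xb t).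
    by apply: hX; apply: le_trans (hT t (ltW Tt)) (z_le_xb t t0).
  have fxb : 0 < f (xb t) by apply/f_gt0/ltW.
  rewrite mulr0 addr0; move: (f (xb t)) (G t) (f (H t)) fxb GS HS => F g fH F0 gS HS kS.
  rewrite mulrC ler_pdivrMr //.
  apply: (@le_trans _ _ ((1 + l) * S * M)).
    have -> : (1 + l) * S * M = S * M + l * M * S by ring.
    by rewrite lerD // ler_wpM2l // ltW.
  rewrite [leRHS]mulrAC ler_pM2r //.
  apply: (@le_trans _ _ (k ^+ 3 * (1 + L + e) * S)); first by rewrite ler_wpM2r.
  by rewrite mulrAC mulrC ler_pM2l.
exists T; exists (Finv (xb T) - (1 + L + e) * M * T) => t Tt.
have t0 : 0 <= t by exact: le_trans (ltW T0) Tt.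
have xt : 0 < x t by apply: lt_le_trans (z_le_x t0); exact: lt_le_trans (z_ge_psi t0).
apply: le_trans (Finv_nondecreasing hf xt (x_le_xb t t0)) _.
have := ac_deriv_le_increment Tt (ac_deriv_linear T t ((1 + L + e) * M))
  (Fac T t (ltW T0) Tt) (fun s Ts _ => key s Ts).
move: (Finv (xb t)) (Finv (xb T)) => F1 F2.
set A := _ * M => hF; lra.
Qed.

(* [J] grows slower than any exponential, since [J' = f (H)], [f] is sublinear
   and [H] is comparable to [J]; so a fixed delay is negligible. *)
Lemma J_shift k T1 : k < 1 -> 0 < T1 ->
  exists2 T, 0 < T & forall t, T <= t -> k * J (t + T1) <= J t.
Proof.
move=> k1 T10; have lM0 : 0 < (L + L) * M by rewrite mulr_gt0 // addr_gt0.
(* On the delay [J' <= eta 2 L M J (t + T1)], a slope whose product with [T1] is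
   [(1 - k) J (t + T1)]. *)
pose eta := (1 - k) / ((L + L) * M * T1).
have eta0 : 0 < eta by apply: divr_gt0; [rewrite subr_gt0|exact: mulr_gt0].
have [X X0 hX] := asymp_class_sublinear_f hphi eta0.
have [C C0 hC] := continuous_bounded hf.1 (ltW X0).
have [T2 T20 hT2] := H_ratio L_gt0.
(* For [H s <= X] only [f (H s) <= C] is known; this makes [J] large enough to dominate [C]. *)
have [T3 T30 hT3] := J_large (C / (eta * ((L + L) * M))).
exists (T2 + T3) => [|t Tt]; first by rewrite addr_gt0.
have T2t : T2 <= t by lra.
have T3t : T3 <= t by lra.
have t0 : 0 <= t by lra.
have tt : t <= t + T1 by lra.
have eL : 0 < eta * ((L + L) * M) by rewrite mulr_gt0.
suff : J (t + T1) - J t <= (1 - k) * J (t + T1) by move: (J _) (J _) => *; lra.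
have E : (1 - k) * J (t + T1) = eta * ((L + L) * M) * J (t + T1) * (t + T1)
    - eta * ((L + L) * M) * J (t + T1) * t.
  move: (J _) => j; rewrite -mulrBr addrAC subrr add0r /eta.
  field; rewrite !gt_eqF //; exact: addr_gt0.
rewrite E.
apply: (ac_deriv_le_increment tt (ac_deriv_linear _ _ _) (J_ac_deriv t0 tt)) => s ts st.
have s0 := le_trans t0 (ltW ts).
have Js := J_nondecreasing s0 (ltW st).
have : f (H s) <= eta * ((L + L) * M) * J s.
  have [HX|XH] := leP (H s) X.
    apply: le_trans (hC _ (hH s0) HX) _; rewrite mulrC -ler_pdivrMr //.
    by apply: hT3; exact: le_trans T3t (ltW ts).
  apply: le_trans (hX _ (ltW XH)) _; rewrite -mulrA ler_pM2l // -mulrA.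
  by have [] := hT2 s (le_trans T2t (ltW ts)).
move=> h1; apply: le_trans h1 _.
by rewrite ler_pM2l.
Qed.

Lemma z_ge_H rho : nonincr_halfline dphi -> 0 < rho -> rho < 1 / L ->
  exists2 T, 0 < T & forall t, T <= t -> 0 < H t /\ rho * H t <= z t.
Proof.
move=> ni rho0 rhoL.
(* Eight losses: four in [fx], one for the mass, one for the shift of [J], one for the constant
   [J T], and one from [J] back to [H]. *)
have [| |k [k0 k1 kq]] := @exists_root_lt1 R 8 (rho * L).
- by rewrite mulr_gt0.
- by rewrite -ltr_pdivlMr.
have [T1 T10 hT1] := segment_mass_ge mu_fin mu_gt0 k0 k1.
have [X X0 hX] := asymp_class_equiv hphi k0 k1.
have k1' : 0 < 1 - k by rewrite subr_gt0.
have [T0 T00 hT0] := @H_ratio ((1 - k) * L) (mulr_gt0 k1' L_gt0).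
have kLM : 0 < k * (L * M) by rewrite !mulr_gt0.
have [T2 T20 hT2] := J_large (X / (k * (L * M))).
have [T3 T30 hT3] := J_shift k1 T10.
pose T := T0 + T2 + T3.
have T_0 : 0 < T by rewrite !addr_gt0.
(* [H] lies between [k L M J] and [(2 - k) L M J], and [k (2 - k) <= 1]. *)
have ratio t : T <= t -> [/\ X <= H t, k * (L * M * J t) <= H t &
    k * H t <= L * M * J t].
  move=> Tt; have Tt0 : T0 <= t by rewrite /T in Tt; lra.
  have /hT2 : T2 <= t by rewrite /T in Tt; lra.
  have t0 : 0 < t by exact: lt_le_trans Tt.
  rewrite ler_pdivrMr // => hJ; have [] := hT0 t Tt0.
  have Jt := J_gt0 t0.
  move: (J t) (H t) hJ Jt => j H' hJ Jt.
  have -> : L - (1 - k) * L = k * L by ring.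
  have -> : L + (1 - k) * L = (2 - k) * L by ring.
  have P0 : 0 < L * M * j by rewrite !mulr_gt0.
  have -> : k * L * (M * j) = k * (L * M * j) by ring.
  have -> : (2 - k) * L * (M * j) = (2 - k) * (L * M * j) by ring.
  have : X <= k * (L * M * j).
    by apply: le_trans hJ _; rewrite le_eqVlt; apply/orP; left; apply/eqP; ring.
  move: (L * M * j) P0 => P P0 hX' hl hu; split => //; first exact: le_trans hl.
  apply: (@le_trans _ _ (k * ((2 - k) * P))); first by rewrite ler_pM2l.
  rewrite mulrA -[leRHS]mul1r ler_wpM2r ?(ltW P0) //.
  by have := sqr_ge0 (1 - k); rewrite expr2; lra.
(* [H] need not be monotone, so [x s] is compared with [H t] through [J]: [x s >= H s >= k L M J s
   >= k L M J t >= k^2 H t]. Two dilations of [phi] and two exchanges of [f] with [phi] then cost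
   [k^4]. *)
have fx t s : T <= t -> t <= s -> k ^+ 4 * f (H t) <= f (x s).
  move=> Tt ts; have [XH kJ Jk] := ratio t Tt.
  have [XHs kJs _] := ratio s (le_trans Tt ts).
  have t0 : 0 <= t by exact: le_trans (ltW T_0) Tt.
  have Js := J_nondecreasing t0 ts.
  have Hx := H_le_x (le_trans t0 ts).
  have LM : 0 < L * M by rewrite mulr_gt0.
  have Jx : k * (L * M * J t) <= x s.
    apply: le_trans Hx; apply: le_trans kJs.
    by rewrite ler_pM2l // ler_pM2l.
  have Xx := le_trans XHs Hx.
  have P0 : 0 < L * M * J t by rewrite mulr_gt0 // J_gt0 //; exact: lt_le_trans Tt.
  move: (L * M * J t) (H t) (x s) P0 XH Jk Jx Xx => P H' y P0 XH Jk Jx Xx.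
  have [kfy _] := hX y Xx; apply: le_trans kfy.
  have [_ kfH] := hX H' XH.
  have H'0 : 0 < H' by exact: lt_le_trans XH.
  have kk0 : 0 < k * (k * H') by rewrite !mulr_gt0.
  rewrite exprS -mulrA ler_pM2l //.
  apply: (@le_trans _ _ (phi (k * (k * H')))); last first.
    apply: (asymp_class_nondecreasing hphi kk0).
    by apply: le_trans Jx; rewrite ler_pM2l.
  have d1 := concave_dilation hphi ni k0 k1 (mulr_gt0 k0 H'0).
  have d2 := concave_dilation hphi ni k0 k1 H'0.
  apply: le_trans d1; rewrite !exprS expr0 mulr1 -!mulrA ler_pM2l //.
  apply: le_trans d2; rewrite ler_pM2l //; exact: kfH.
have T0' : 0 <= T + T1 by rewrite addr_ge0 // ltW.
have k5M : 0 < k ^+ 5 * M by rewrite mulr_gt0 // exprn_gt0.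
have zJ t : T + T1 <= t -> k ^+ 5 * M * (J (t - T1) - J T) <= z t.
  move=> Tt.
  have acJ : ac_deriv (T + T1) t (fun s => 0 * s + k ^+ 5 * M * J (s - T1))
      (fun s => 0 + k ^+ 5 * M * f (H (s - T1))).
    apply: ac_deriv_axpy (ac_deriv_linear _ _ _) (J_shift_ac_deriv _ Tt).
    by rewrite addrK ltW.
  have := ac_deriv_le_increment Tt (z_ac_deriv T0' Tt) acJ.
  have z0 := le_trans (ltW hpsi) (z_ge_psi T0').
  rewrite !mul0r !add0r addrK mulrBr => inc.
  apply: le_trans (inc _) _; last by rewrite lerBlDr lerDl.
  move=> s Ts st; have Ts' : T <= s - T1 by lra.
  have T1s : T1 <= s by lra.
  apply: le_trans (G_ge (ltW T10) T1s _ (fun y ys _ => fx _ y Ts' ys)); last first.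
    rewrite mulr_ge0 ?exprn_ge0 ?ltW // f_gt0 // hH //.
    exact: le_trans (ltW T_0) Ts'.
  have fH : 0 < f (H (s - T1)).
    by apply/f_gt0/hH; exact: le_trans (ltW T_0) Ts'.
  rewrite add0r; move: (f _) fH => F F0.
  have -> : k ^+ 5 * M * F = k ^+ 4 * F * (k * M) by ring.
  by rewrite ler_pM2l // mulr_gt0 // exprn_gt0.
(* This gives [J T <= k (1 - k) J t], so [J (t - T1) >= k J t] leaves
   [J (t - T1) - J T >= k^2 J t]. *)
have [T4 T40 hT4] := J_large (J T / (k * (1 - k))).
exists (T + T1 + T4) => [|t Tt]; first by rewrite !addr_gt0.
have Tt0 : T <= t by lra.
have Tt1 : T + T1 <= t by lra.
have T3t : T3 <= t - T1 by rewrite /T in Tt; lra.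
have /hT4 : T4 <= t by lra.
rewrite ler_pdivrMr ?mulr_gt0 // => hJ.
have [XH kJ Jk] := ratio t Tt0.
split; first exact: lt_le_trans XH.
have := hT3 _ T3t; rewrite subrK => hs; have := zJ t Tt1.
apply: le_trans.
move: (J (t - T1)) (J t) (J T) (H t) hs hJ Jk (lt_le_trans X0 XH) => j j1 j2 H'.
move=> hs hJ Jk H0.
have k50 : 0 < k ^+ 5 by rewrite exprn_gt0.
have k70 : 0 < k ^+ 7 by rewrite exprn_gt0.
apply: (@le_trans _ _ (k ^+ 7 * (M * j1))).
  have : k * H' / L <= M * j1 by rewrite ler_pdivrMr // -[leRHS]mulrC mulrA.
  move=> h1; apply: (@le_trans _ _ (k ^+ 7 * (k * H' / L))); last by rewrite ler_pM2l.
  have -> : k ^+ 7 * (k * H' / L) = k ^+ 8 * H' / L by ring.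
  by rewrite ler_pdivlMr // mulrAC ler_pM2r.
have -> : k ^+ 7 * (M * j1) = k ^+ 5 * M * (k * (k * j1)) by ring.
rewrite ler_pM2l //.
have -> : k * (k * j1) = k * j1 - j1 * (k * (1 - k)) by ring.
lra.
Qed.

End equation.

(** * From the eventual bounds to the limits *)

Theorem theorem2p9 (R : realType)
    (mu : {measure set (measurableTypeR R) -> \bar R})
    (f h : R -> R) (psi L : R)
    (mu_gt0 : (0 < mu (halfline R))%E) (mu_fin : (mu (halfline R) < +oo)%E)
    (hf : cont_pos f)
    (hh : L1loc h) (hH : forall t : R, 0 <= t -> 0 <= primitive0 h t)
    (hpsi : 0 < psi)
    (hphi : exists phi dphi : R -> R, asymp_class f phi dphi)
    (hL : primitive0 h t /
            (total_mass mu * primitive0 (fun s => f (primitive0 h s)) t)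
          @[t --> +oo] --> L)
    (L_gt0 : 0 < L)
    (x : R -> R) (hx : is_solution mu f h psi x) :
  [/\ (1%:E <= limf_einf (fun t : R => (Fint f (x t) / (total_mass mu * t))%:E)
                 +oo%R)%E,
      (limf_einf (fun t : R => (Fint f (x t) / (total_mass mu * t))%:E) +oo%R
       <= limf_esup (fun t : R => (Fint f (x t) / (total_mass mu * t))%:E)
            +oo%R)%E,
      (limf_esup (fun t : R => (Fint f (x t) / (total_mass mu * t))%:E) +oo%R
       <= (1 + L)%:E)%E
    & (exists phi dphi : R -> R,
          asymp_class f phi dphi /\ nonincr_halfline dphi) ->
      ((1 + 1 / L)%:E
       <= limf_einf (fun t : R => (x t / primitive0 h t)%:E) +oo%R)%E].
Proof.
have M0 : 0 < total_mass mu := total_mass_gt0 mu_fin mu_gt0.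
have x0 t : 0 <= t -> 0 <= x t by case: hx => _ + _ _; apply.
set F1 := primitive0 (fun y => (f y)^-1) 1.
have FE t : 0 <= t -> Fint f (x t) = primitive0 (fun y => (f y)^-1) (x t) - F1.
  by move=> t0; apply: Fint_primitive0 => //; exact: x0.
case: hphi => phi [dphi hp]; split.
- apply: limf_einf_ge => e e0; have e20 : 0 < e / 2 by lra.
  (* The cap at 1 keeps the slope [b] positive; half of the error goes into the slope, half into the
     additive constant. *)
  pose e' := Num.min e 1.
  have e'0 : 0 < e' by rewrite lt_min e0 ltr01.
  have e'1 : e' <= 1 by rewrite ge_min lexx orbT.
  have e'e : e' <= e by rewrite ge_min lexx.
  pose b := total_mass mu * (1 - e' / 2).
  have b0 : 0 < b by rewrite mulr_gt0 //; lra.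
  have bM : b < total_mass mu by rewrite -[ltRHS]mulr1 ltr_pM2l //; lra.
  have [T [k hT]] := Finv_x_ge_affine mu_gt0 mu_fin hf hh hH hpsi hp hx b0 bM.
  (* [T] may be negative, while [FE] requires [0 <= t]. *)
  have hT' t : Num.max T 0 <= t -> b * t + (k - F1) <= Fint f (x t).
    by rewrite ge_max => /andP[Tt t0]; rewrite FE // addrA lerB // hT.
  have [T' T'0 hT''] := affine_ratio_ge M0 hT' e20.
  exists T' => // t /hT''; apply: le_trans.
  rewrite /b mulrAC divff ?gt_eqF // mul1r; lra.
- exact: limf_einf_le_esup.
- apply: limf_esup_le => e e0; have e20 : 0 < e / 2 by lra.
  have [T [k hT]] := Finv_x_le_affine mu_gt0 mu_fin hf hh hH hpsi hp hx hL L_gt0 e20.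
  have hT' t : Num.max T 0 <= t ->
      Fint f (x t) <= (1 + L + e / 2) * total_mass mu * t + (k - F1).
    by rewrite ge_max => /andP[Tt t0]; rewrite FE // addrA lerB // hT.
  have [T' T'0 hT''] := affine_ratio_le M0 hT' e20.
  exists T' => // t /hT'' /le_trans; apply.
  rewrite mulfK ?gt_eqF //; lra.
- move=> [phi' [dphi' [hp' ni]]]; apply: limf_einf_ge => e e0.
  have L1 : 0 < 1 / L by rewrite divr_gt0.
  (* The cap at half of [1 / L] keeps [rho] positive. *)
  pose rho := 1 / L - Num.min e (1 / L / 2).
  have e'e : Num.min e (1 / L / 2) <= e by rewrite ge_min lexx.
  have e'L : Num.min e (1 / L / 2) <= 1 / L / 2 by rewrite ge_min lexx orbT.
  have e'0 : 0 < Num.min e (1 / L / 2) by rewrite lt_min e0 divr_gt0.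
  have rho0 : 0 < rho by rewrite /rho; lra.
  have rhoL : rho < 1 / L by rewrite /rho; lra.
  have [T T0 hT] := z_ge_H mu_gt0 mu_fin hf hh hH hpsi hp' hx hL L_gt0 ni rho0 rhoL.
  (* [z >= rho H] reads [x >= (1 + rho) H], which is divided by [H t > 0]. *)
  exists T => // t /hT[H0]; rewrite mulN1r lerBrDr => zH.
  rewrite ler_pdivlMr //; apply: le_trans zH.
  rewrite -[X in _ <= _ + X]mul1r -mulrDl ler_wpM2r ?(ltW H0) // /rho; lra.
Qed.
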